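(* Let $\mathcal{L}$ be an $\mathbb{R}$-local system on $U$ and let $(Q_s)_{s\in I}$ be a smooth $1$-parameter family of non-degenerate symmetric or anti-symmetric pairings of $\mathcal{L}$ parametrized by an interval $I\subset\mathbb{R}$. Then $I$ admits an open cover $I=\bigcup_{j\in J}I_j$ such that for every $j\in J$ there exists a smooth family of automorphisms $T(s)$ of $\mathcal{L}$, $s\in I_j$, such that the pairing $Q_s(T(s)(-),T(s)(-))$ is independent of $s\in I_j$. Consequently, for any $s,s'\in I$ there is an automorphism $T_{s,s'}$ of $\mathcal{L}$ such that $$Q_{s'}(T_{s,s'}(-),T_{s,s'}(-))=Q_s(-,-).$$
   Context: $U$ is a nonempty Zariski open subset of an irreducible complex algebraic variety (in particular connected). Local systems have finite rank. A pairing of $\mathcal{L}$ is a morphism of local systems $\mathcal{L}\otimes\mathcal{L}\to\mathbb{R}_U$; all $Q_s$ are symmetric, or all are anti-symmetric. An automorphism of $\mathcal{L}$ is an automorphism of local systems (i.e. commuting with the monodromy). Smoothness of families in $s$ means smoothness in $s$ of the induced bilinear forms on, respectively linear automorphisms of, a stalk $\mathcal{L}_y$, $y\in U$. No semi-simplicity of $\mathcal{L}$ is assumed. *)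

(* Defs.v *)
From HB Require Import structures.
From mathcomp Require Import all_boot all_order all_algebra.
From mathcomp Require Import all_classical all_reals all_analysis.
From mathcomp Require Import generic_quotient complex.
(* mpoly is not imported: its notations clash with those of
   mathcomp-analysis. *)
From mathcomp.multinomials Require mpoly.

Set Implicit Arguments.
Unset Strict Implicit.
Unset Printing Implicit Defensive.

Import Order.TTheory GRing.Theory Num.Theory numFieldNormedType.Exports.
Local Open Scope classical_set_scope.
Local Open Scope ring_scope.

(* Complex algebraic varieties: separated reduced schemes of finite type over
   the complex numbers, presented (as in Serre's FAC) by a finite atlas of
   affine algebraic sets. *)

(* The cast to numClosedFieldType makes the topology given by the complex
   norm available. *)
Definition Cplx (R : realType) : numClosedFieldType := R[i].

Section AffineSpace.
Variable R : realType.

Definition cpoly n := mpoly.mpoly n (Cplx R).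

Definition peval n (p : cpoly n) (z : 'rV[Cplx R]_n) : Cplx R :=
  mpoly.meval (fun k => z 0 k) p.

Definition zclosed n (Z : set 'rV[Cplx R]_n) :=
  exists S : set (cpoly n), Z = [set z | forall p, S p -> peval p z = 0].

(* [g] is a regular function, in the coordinates [c], on a set [W] that [c]
   identifies with an open subset of an affine algebraic set: around each point
   it is a quotient of polynomials.  The neighbourhood on which this holds can
   be taken to be the locus where the denominator does not vanish. *)
Definition regular_on (T : Type) n (W : set T) (c : T -> 'rV[Cplx R]_n)
    (g : T -> Cplx R) :=
  forall x, W x -> exists p q : cpoly n, peval q (c x) != 0 /\
    forall y, W y -> peval q (c y) != 0 ->
      g y = peval p (c y) / peval q (c y).

End AffineSpace.

Record variety (R : realType) := Variety {
  points :> choiceType;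
  ncharts : nat;
  cdim : 'I_ncharts -> nat;
  dom : 'I_ncharts -> set points;
  (* the value of [coord i] outside [dom i] is irrelevant *)
  coord : forall i, points -> 'rV[Cplx R]_(cdim i);
  dom_cover : forall x, exists i, dom i x;
  coord_inj : forall i x y, dom i x -> dom i y ->
    coord i x = coord i y -> x = y;
  coord_affine : forall i, zclosed (coord i @` dom i);
  overlap_open : forall i j, exists2 Z, zclosed Z &
    forall x, dom i x -> (dom j x <-> ~ Z (coord i x));
  transition_regular : forall i j k,
    regular_on (dom i `&` dom j) (coord i) (fun x => coord j x 0 k);
  separated_diag : forall i j,
    zclosed [set row_mx (coord i x) (coord j x) | x in dom i `&` dom j]
}.

Section VarietyTopologies.
Variables (R : realType) (X : variety R).

Definition zariski_open (A : set X) :=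
  forall i : 'I_(ncharts X), exists2 Z, zclosed Z &
    forall x : X, dom i x -> (A x <-> ~ Z (coord i x)).

Definition irreducible_variety :=
  [set: X] !=set0 /\ forall A B : set X, zariski_open (~` A) ->
    zariski_open (~` B) -> A `|` B = setT -> A = setT \/ B = setT.

Definition classical_open (A : set X) :=
  forall i : 'I_(ncharts X), exists2 G : set 'rV[Cplx R]_(cdim i), open G &
    forall x : X, dom i x -> (A x <-> G (coord i x)).

Lemma classical_openT : classical_open setT.
Proof. by move=> i; exists setT => //; exact: openT. Qed.

Lemma classical_openI : setI_closed classical_open.
Proof.
move=> A B oA oB i; have [G oG AG] := oA i; have [H oH BH] := oB i.
exists (G `&` H); first exact: openI.
by move=> x ix; split=> -[a b]; split; by [apply/(AG x ix)|apply/(BH x ix)].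
Qed.

Lemma classical_open_bigU (I : Type) (f : I -> set X) :
  (forall i, classical_open (f i)) -> classical_open (\bigcup_i f i).
Proof.
move=> of_f i.
have /choice[G GP] : forall j, exists G : set 'rV[Cplx R]_(cdim i),
    open G /\ forall x : X, dom i x -> (f j x <-> G (coord i x)).
  by move=> j; have [G oG fG] := of_f j i; exists G.
exists (\bigcup_j G j); first by apply: bigcup_open => j _; case: (GP j).
by move=> x ix; split=> -[j _ h]; exists j => //; case: (GP j) => _ /(_ x ix) [];
  auto.
Qed.

End VarietyTopologies.

(* The set of points of [X] with its classical (Euclidean) topology. *)
Definition analytic (R : realType) (X : variety R) : Type := points X.

HB.instance Definition _ (R : realType) (X : variety R) :=
  Choice.on (analytic X).
HB.instance Definition _ (R : realType) (X : variety R) :=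
  isOpenTopological.Build (analytic X) (@classical_openT R X)
    (@classical_openI R X) (@classical_open_bigU R X).

Section Sheaves.
Variables (R : realType) (T : topologicalType).

(* Sheaves of real vector spaces on [T]; only the values of [sec] on open sets
   are meaningful. *)
Record vsheaf := VSheaf {
  sec : set T -> lmodType R;
  res : forall V W : set T, W `<=` V -> {linear sec V -> sec W};
  res_id : forall V (VV : V `<=` V) (s : sec V), open V -> res VV s = s;
  res_comp : forall V W X (WV : W `<=` V) (XW : X `<=` W) (XV : X `<=` V)
    (s : sec V), open V -> open W -> open X ->
    res XW (res WV s) = res XV s;
  sheaf_locality : forall (D : set (set T)) (X : set T),
    D `<=` open -> X = \bigcup_(V in D) V -> forall s t : sec X,
    (forall V (VX : V `<=` X), D V -> res VX s = res VX t) -> s = t;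
  sheaf_gluing : forall (D : set (set T)) (X : set T),
    D `<=` open -> X = \bigcup_(V in D) V -> forall s : forall V, sec V,
    (forall V W, D V -> D W ->
      res (@subIsetl T V W) (s V) = res (@subIsetr T V W) (s W)) ->
    exists t : sec X, forall V (VX : V `<=` X), D V -> res VX t = s V
}.

Arguments res {v V W} WV.

Section ConstantSheaf.
Variable E : lmodType R.

(* Locally constant functions on [V], extended by zero. *)
Definition lcfun (V : set T) : {pred T -> E} := fun f =>
  `[< (forall x, ~ V x -> f x = 0) /\
      (forall x, V x -> \forall y \near x, V y -> f y = f x) >].

Lemma lcfunP V f : f \in lcfun V <->
  (forall x, ~ V x -> f x = 0) /\ (forall x, V x -> \forall y \near x, V y -> f y = f x).
Proof. by split=> [/asboolP|h] //; apply/asboolP. Qed.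

Lemma lcfun_submod_closed V : GRing.submod_closed (lcfun V).
Proof.
split.
  by apply/lcfunP; split=> // x _; exact: nearW.
move=> a f g /lcfunP[f0 fl] /lcfunP[g0 gl]; apply/lcfunP; split=> x Vx.
  have -> : (a *: f + g) x = a *: f x + g x by [].
  by rewrite f0 // g0 // scaler0 addr0.
near=> y => Vy; have -> z : (a *: f + g) z = a *: f z + g z by [].
have -> : f y = f x by move: Vy; near: y; exact: fl.
by have -> : g y = g x by move: Vy; near: y; exact: gl.
Unshelve. all: by end_near. Qed.

HB.instance Definition _ V := GRing.isSubmodClosed.Build R (T -> E) (lcfun V)
  (lcfun_submod_closed V).

Record cst_sec (V : set T) := CstSec {
  cst_fun :> T -> E;
  cst_funP : cst_fun \in lcfun V
}.

HB.instance Definition _ V := [isSub for @cst_fun V].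
HB.instance Definition _ V := [Choice of cst_sec V by <:].
HB.instance Definition _ V := [SubChoice_isSubLmodule of cst_sec V by <:].

Lemma cst_res_subproof V W (WV : W `<=` V) (f : cst_sec V) :
  patch (fun=> 0) W f \in lcfun W.
Proof.
have /lcfunP[_ fl] := cst_funP f; apply/lcfunP; split=> x Wx.
  by rewrite /patch memNset.
have := fl x (WV x Wx); apply: filterS => y fy Wy.
by rewrite /patch !mem_set //; exact/fy/WV.
Qed.

Definition cst_res V W (WV : W `<=` V) (f : cst_sec V) : cst_sec W :=
  CstSec (cst_res_subproof WV f).

Lemma cst_resE V W (WV : W `<=` V) (f : cst_sec V) x :
  W x -> cst_res WV f x = f x.
Proof. by move=> Wx; rewrite /= /patch mem_set. Qed.

Lemma cst_sec_eq V (f g : cst_sec V) : (forall x, V x -> f x = g x) -> f = g.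
Proof.
move=> fg; apply/val_inj/funext => x /=.
have [Vx|Vx] := pselect (V x); first exact: fg.
have /lcfunP[-> // _] := cst_funP f; by have /lcfunP[-> // _] := cst_funP g.
Qed.

Lemma cst_res_linear V W (WV : W `<=` V) : linear (cst_res WV).
Proof.
move=> a f g; apply: cst_sec_eq => x Wx.
rewrite [RHS](_ : _ = a *: cst_res WV f x + cst_res WV g x) //.
by rewrite !cst_resE.
Qed.

HB.instance Definition _ V W (WV : W `<=` V) :=
  GRing.isLinear.Build R (cst_sec V) (cst_sec W) _ (cst_res WV)
    (cst_res_linear WV).

Lemma cst_res_id V (VV : V `<=` V) (f : cst_sec V) : open V -> cst_res VV f = f.
Proof. by move=> _; apply: cst_sec_eq => x Vx; rewrite cst_resE. Qed.

Lemma cst_res_comp V W X (WV : W `<=` V) (XW : X `<=` W) (XV : X `<=` V)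
    (f : cst_sec V) : open V -> open W -> open X ->
  cst_res XW (cst_res WV f) = cst_res XV f.
Proof.
by move=> _ _ _; apply: cst_sec_eq => x Xx; rewrite !cst_resE //; exact: XW.
Qed.

Lemma cst_locality (D : set (set T)) (X : set T) : D `<=` open ->
  X = \bigcup_(V in D) V -> forall f g : cst_sec X,
  (forall V (VX : V `<=` X), D V -> cst_res VX f = cst_res VX g) -> f = g.
Proof.
move=> _ XD f g fg; apply: cst_sec_eq => x; rewrite {1}XD => -[V DV Vx].
have VX : V `<=` X by rewrite XD; exact: bigcup_sup.
by rewrite -(cst_resE VX) // fg // cst_resE.
Qed.

Lemma cst_gluing (D : set (set T)) (X : set T) : D `<=` open ->
  X = \bigcup_(V in D) V -> forall f : forall V, cst_sec V,
  (forall V W, D V -> D W ->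
    cst_res (@subIsetl T V W) (f V) = cst_res (@subIsetr T V W) (f W)) ->
  exists g : cst_sec X, forall V (VX : V `<=` X), D V -> cst_res VX g = f V.
Proof.
move=> Dop XD f fcompat.
have fE V W x : D V -> D W -> V x -> W x -> f V x = f W x.
  move=> DV DW Vx Wx; have /(congr1 (fun h : cst_sec _ => h x)) := fcompat V W DV DW.
  by rewrite !cst_resE.
pose g x : E := if pselect (exists2 V, D V & V x) is left e
  then f (projT1 (cid2 e)) x else 0.
have gE V x : D V -> V x -> g x = f V x.
  move=> DV Vx; rewrite /g; case: pselect => [e|[]]; last by exists V.
  by case: cid2 => W /= DW Wx; exact: fE.
have gP : g \in lcfun X.
  apply/lcfunP; split=> x.
    by rewrite XD /g => nx; case: pselect => // -[V DV Vx]; case: nx; exists V.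
  rewrite {1}XD => -[V DV Vx].
  have /lcfunP[_ /(_ x Vx) fl] := cst_funP (f V).
  have := open_nbhs_nbhs (conj (Dop _ DV) Vx).
  apply: filterS2 fl => y fy Vy _; rewrite !(gE V) //; exact: fy.
exists (CstSec gP) => V VX DV; apply: cst_sec_eq => x Vx.
by rewrite cst_resE //=; exact: gE.
Qed.

Definition cst_sheaf : vsheaf := VSheaf
  (sec := cst_sec) (res := fun V W WV => cst_res WV)
  cst_res_id cst_res_comp cst_locality cst_gluing.

End ConstantSheaf.

Record vsheaf_hom (F G : vsheaf) := VSheafHom {
  hom_fun :> forall V, {linear sec F V -> sec G V};
  hom_res : forall V W (WV : W `<=` V) (s : sec F V), open V -> open W ->
    hom_fun W (res WV s) = res WV (hom_fun V s)
}.

Definition is_automorphism (F : vsheaf) (f : vsheaf_hom F F) :=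
  exists g : vsheaf_hom F F, forall V (s : sec F V), open V ->
    g V (f V s) = s /\ f V (g V s) = s.

(* Every point has an open neighbourhood [V] on which [F] is isomorphic to the
   constant sheaf R^n; [phi] is the isomorphism, so only its components at open
   subsets of [V] matter. *)
Definition locally_constant (F : vsheaf) :=
  forall x : T, exists (V : set T) (n : nat)
    (phi : forall W, {linear sec F W -> sec (cst_sheaf 'rV[R]_n) W}),
    [/\ open V, V x,
        forall W, open W -> W `<=` V -> bijective (phi W)
      & forall W W' (W'W : W' `<=` W) (s : sec F W), open W -> open W' ->
          W `<=` V -> phi W' (res W'W s) = res W'W (phi W s)].

Record local_system := LocalSystem {
  ls_sheaf :> vsheaf;
  ls_locally_constant : locally_constant ls_sheaf
}.

(* By the universal property of the tensor product of sheaves, a morphism from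
   [F (x) F] to the constant sheaf R is a family of bilinear maps compatible
   with restriction. *)
Record pairing (F : vsheaf) := Pairing {
  pair_fun :> forall V, sec F V -> sec F V -> sec (cst_sheaf R^o) V;
  pair_linl : forall V (t : sec F V), linear (fun s => pair_fun s t);
  pair_linr : forall V (s : sec F V), linear (pair_fun s);
  pair_res : forall V W (WV : W `<=` V) (s t : sec F V), open V -> open W ->
    pair_fun (res WV s) (res WV t) = res WV (pair_fun s t)
}.

Definition symmetric_pairing (F : vsheaf) (Q : pairing F) :=
  forall V (s t : sec F V), open V -> Q V s t = Q V t s.

Definition antisymmetric_pairing (F : vsheaf) (Q : pairing F) :=
  forall V (s t : sec F V), open V -> Q V s t = - Q V t s.

Section Stalk.
Variables (F : vsheaf) (x : T).

Record pregerm := PreGerm {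
  pg_dom : set T;
  pg_open : open pg_dom;
  pg_mem : pg_dom x;
  pg_sec : sec F pg_dom
}.

HB.instance Definition _ := gen_eqMixin pregerm.
HB.instance Definition _ := gen_choiceMixin pregerm.

Definition same_germ (a b : pregerm) : bool :=
  `[< exists (W : set T) (Wa : W `<=` pg_dom a) (Wb : W `<=` pg_dom b),
      [/\ open W, W x & res Wa (pg_sec a) = res Wb (pg_sec b)] >].

Lemma same_germ_refl : reflexive same_germ.
Proof.
move=> a; apply/asboolP; exists (pg_dom a), (@subset_refl _ _), (@subset_refl _ _).
by split=> //; [exact: pg_open|exact: pg_mem].
Qed.

Lemma same_germ_sym : symmetric same_germ.
Proof.
by move=> a b; apply/asboolP/asboolP => -[W [Wa [Wb [? ? ?]]]]; exists W, Wb, Wa.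
Qed.

Lemma same_germ_trans : transitive same_germ.
Proof.
move=> b a c /asboolP[V [Va [Vb [oV Vx ab]]]] /asboolP[W [Wb [Wc [oW Wx bc]]]].
have VWV := @subIsetl T V W; have VWW := @subIsetr T V W.
have [[oa ob] oc] := (pg_open a, pg_open b, pg_open c).
have oVW := openI oV oW.
apply/asboolP; exists (V `&` W), (subset_trans VWV Va), (subset_trans VWW Wc).
split=> //.
rewrite -(res_comp Va VWV) // ab -(res_comp Wc VWW) // -bc.
by rewrite !(res_comp _ _ (subset_trans VWV Vb)).
Qed.

Canonical same_germ_equiv :=
  EquivRel same_germ same_germ_refl same_germ_sym same_germ_trans.

Definition stalk := {eq_quot same_germ}%qT.
HB.instance Definition _ := Choice.on stalk.
HB.instance Definition _ := EqQuotient.on stalk.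

Definition germ V (oV : open V) (Vx : V x) (s : sec F V) : stalk :=
  (\pi_stalk)%qT (PreGerm oV Vx s).

Lemma germP V W (oV : open V) (Vx : V x) (oW : open W) (Wx : W x)
    (s : sec F V) (t : sec F W) : germ oV Vx s = germ oW Wx t <->
  exists (X : set T) (XV : X `<=` V) (XW : X `<=` W),
    [/\ open X, X x & res XV s = res XW t].
Proof.
rewrite /germ; split=> [/eqquotP/asboolP //|h].
by apply/eqquotP/asboolP.
Qed.

Lemma germ_res V W (WV : W `<=` V) (oV : open V) (Vx : V x) (oW : open W)
  (Wx : W x) (s : sec F V) : germ oW Wx (res WV s) = germ oV Vx s.
Proof.
apply/germP; exists W, (@subset_refl _ _), WV; split=> //.
by rewrite res_id.
Qed.

Lemma germ_surj (a : stalk) : exists V (oV : open V) (Vx : V x) (s : sec F V),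
  a = germ oV Vx s.
Proof.
elim/quotW: a => -[V oV Vx s]; by exists V, oV, Vx, s.
Qed.

Lemma germ_surj2 (a b : stalk) : exists V (oV : open V) (Vx : V x)
  (s t : sec F V), a = germ oV Vx s /\ b = germ oV Vx t.
Proof.
have [V [oV [Vx [s ->]]]] := germ_surj a.
have [W [oW [Wx [t ->]]]] := germ_surj b.
exists (V `&` W), (openI oV oW), (conj Vx Wx).
exists (res (@subIsetl T V W) s), (res (@subIsetr T V W) t).
by rewrite !germ_res.
Qed.

Lemma germ_surj3 (a b c : stalk) : exists V (oV : open V) (Vx : V x)
  (s t u : sec F V), [/\ a = germ oV Vx s, b = germ oV Vx t & c = germ oV Vx u].
Proof.
have [V [oV [Vx [s [t [-> ->]]]]]] := germ_surj2 a b.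
have [W [oW [Wx [u ->]]]] := germ_surj c.
exists (V `&` W), (openI oV oW), (conj Vx Wx).
exists (res (@subIsetl T V W) s), (res (@subIsetl T V W) t).
by exists (res (@subIsetr T V W) u); rewrite !germ_res.
Qed.

Definition stalk_add (a b : stalk) : stalk :=
  let V := pg_dom (repr a) in let W := pg_dom (repr b) in
  germ (openI (pg_open (repr a)) (pg_open (repr b)))
       (conj (pg_mem (repr a)) (pg_mem (repr b)))
       (res (@subIsetl T V W) (pg_sec (repr a)) +
        res (@subIsetr T V W) (pg_sec (repr b))).

Definition stalk_scale (k : R) (a : stalk) : stalk :=
  germ (pg_open (repr a)) (pg_mem (repr a)) (k *: pg_sec (repr a)).

Definition stalk_zero : stalk := germ openT I (0 : sec F setT).

Lemma repr_germ V (oV : open V) (Vx : V x) (s : sec F V) :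
  exists (X : set T) (Xr : X `<=` pg_dom (repr (germ oV Vx s))) (XV : X `<=` V),
    [/\ open X, X x & res Xr (pg_sec (repr (germ oV Vx s))) = res XV s].
Proof.
have : germ (pg_open (repr (germ oV Vx s))) (pg_mem (repr (germ oV Vx s)))
    (pg_sec (repr (germ oV Vx s))) = germ oV Vx s.
  by rewrite -[RHS]reprK /germ; case: (repr _).
by move=> /germP.
Qed.

Lemma stalk_addE V (oV : open V) (Vx : V x) (s t : sec F V) :
  stalk_add (germ oV Vx s) (germ oV Vx t) = germ oV Vx (s + t).
Proof.
have [A [Ar [AV [oA Ax As]]]] := repr_germ oV Vx s.
have [B [Br [BV [oB Bx Bt]]]] := repr_germ oV Vx t.
rewrite /stalk_add; set a := repr _ in Ar As *; set b := repr _ in Br Bt *.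
have ABa := subset_trans (@subIsetl T A B) Ar.
have ABb := subset_trans (@subIsetr T A B) Br.
have ABV := subset_trans (@subIsetl T A B) AV.
have oAB := openI oA oB.
have [oa ob] := (pg_open a, pg_open b); have oab := openI oa ob.
have ABab : A `&` B `<=` pg_dom a `&` pg_dom b by move=> z [/Ar ? /Br].
apply/germP; exists (A `&` B), ABab, ABV; split=> //.
rewrite !linearD /= (res_comp _ _ ABa) // (res_comp _ _ ABb) //; congr (_ + _).
  by rewrite -(res_comp Ar (@subIsetl T A B)) // As (res_comp _ _ ABV).
by rewrite -(res_comp Br (@subIsetr T A B)) // Bt (res_comp _ _ ABV).
Qed.

Lemma stalk_scaleE k V (oV : open V) (Vx : V x) (s : sec F V) :
  stalk_scale k (germ oV Vx s) = germ oV Vx (k *: s).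
Proof.
have [A [Ar [AV [oA Ax As]]]] := repr_germ oV Vx s.
by apply/germP; exists A, Ar, AV; split=> //; rewrite !linearZ /= As.
Qed.

Lemma stalk_zeroE V (oV : open V) (Vx : V x) : stalk_zero = germ oV Vx 0.
Proof.
apply/germP; exists V, (@subsetT _ _), (@subset_refl _ _); split=> //.
by rewrite !linear0.
Qed.

Lemma stalk_addA : associative stalk_add.
Proof.
move=> a b c; have [V [oV [Vx [s [t [u [-> -> ->]]]]]]] := germ_surj3 a b c.
by rewrite !stalk_addE addrA.
Qed.

Lemma stalk_addC : commutative stalk_add.
Proof.
move=> a b; have [V [oV [Vx [s [t [-> ->]]]]]] := germ_surj2 a b.
by rewrite !stalk_addE addrC.
Qed.

Lemma stalk_add0 : left_id stalk_zero stalk_add.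
Proof.
move=> a; have [V [oV [Vx [s ->]]]] := germ_surj a.
by rewrite (stalk_zeroE oV Vx) stalk_addE add0r.
Qed.

Lemma stalk_addN : left_inverse stalk_zero (stalk_scale (-1)) stalk_add.
Proof.
move=> a; have [V [oV [Vx [s ->]]]] := germ_surj a.
by rewrite stalk_scaleE stalk_addE (stalk_zeroE oV Vx) scaleN1r addNr.
Qed.

HB.instance Definition _ := GRing.isZmodule.Build stalk
  stalk_addA stalk_addC stalk_add0 stalk_addN.

Lemma stalk_scaleA j k a :
  stalk_scale j (stalk_scale k a) = stalk_scale (j * k) a.
Proof.
have [V [oV [Vx [s ->]]]] := germ_surj a.
by rewrite !stalk_scaleE scalerA.
Qed.

Lemma stalk_scale1 : left_id 1 stalk_scale.
Proof.
move=> a; have [V [oV [Vx [s ->]]]] := germ_surj a.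
by rewrite stalk_scaleE scale1r.
Qed.

Lemma stalk_scaleDr : right_distributive stalk_scale +%R.
Proof.
move=> k a b; have [V [oV [Vx [s [t [-> ->]]]]]] := germ_surj2 a b.
by rewrite /GRing.add /= !(stalk_scaleE, stalk_addE) scalerDr.
Qed.

Lemma stalk_scaleDl a : {morph stalk_scale^~ a : j k / j + k}.
Proof.
move=> j k; have [V [oV [Vx [s ->]]]] := germ_surj a.
by rewrite [RHS]/GRing.add /= !(stalk_scaleE, stalk_addE) scalerDl.
Qed.

HB.instance Definition _ := GRing.Zmodule_isLmodule.Build R stalk
  stalk_scaleA stalk_scale1 stalk_scaleDr stalk_scaleDl.

End Stalk.

Definition stalk_map (F G : vsheaf) (f : vsheaf_hom F G) (x : T)
    (a : stalk F x) : stalk G x :=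
  germ (pg_open (repr a)) (pg_mem (repr a)) (f _ (pg_sec (repr a))).

Lemma stalk_mapE (F G : vsheaf) (f : vsheaf_hom F G) (x : T) V (oV : open V)
  (Vx : V x) (s : sec F V) :
  stalk_map f (germ oV Vx s) = germ oV Vx (f V s).
Proof.
have [A [Ar [AV [oA Ax As]]]] := repr_germ oV Vx s.
apply/germP; exists A, Ar, AV; split=> //.
by rewrite -!hom_res // ?As //; exact: pg_open.
Qed.

Definition stalk_form (F : vsheaf) (Q : pairing F) (x : T)
    (a b : stalk F x) : R :=
  let V := pg_dom (repr a) in let W := pg_dom (repr b) in
  (Q _ (res (@subIsetl T V W) (pg_sec (repr a)))
       (res (@subIsetr T V W) (pg_sec (repr b))) : cst_sec R^o (V `&` W)) x.

Lemma stalk_formE (F : vsheaf) (Q : pairing F) (x : T) V (oV : open V)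
  (Vx : V x) (s t : sec F V) :
  stalk_form Q (germ oV Vx s) (germ oV Vx t) = (Q V s t : cst_sec R^o V) x.
Proof.
have [A [Ar [AV [oA Ax As]]]] := repr_germ oV Vx s.
have [B [Br [BV [oB Bx Bt]]]] := repr_germ oV Vx t.
rewrite /stalk_form; set a := repr _ in Ar As *; set b := repr _ in Br Bt *.
have ABa := subset_trans (@subIsetl T A B) Ar.
have ABb := subset_trans (@subIsetr T A B) Br.
have ABV := subset_trans (@subIsetl T A B) AV.
have oAB := openI oA oB.
have [oa ob] := (pg_open a, pg_open b); have oab := openI oa ob.
have ABab : A `&` B `<=` pg_dom a `&` pg_dom b by move=> z [/Ar ? /Br].
have ABx : (A `&` B) x by [].
rewrite -(cst_resE ABab) // -[RHS](cst_resE ABV) //.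
congr ((_ : cst_sec R^o (A `&` B)) x).
have /= <- := pair_res Q ABab _ _ oab oAB; have /= <- := pair_res Q ABV s t oV oAB.
congr (Q _ _ _); rewrite ?(res_comp _ _ ABa) ?(res_comp _ _ ABb) //.
  by rewrite -(res_comp Ar (@subIsetl T A B)) // As (res_comp _ _ ABV).
by rewrite -(res_comp Br (@subIsetr T A B)) // Bt (res_comp _ _ ABV).
Qed.

Definition nondegenerate_pairing (F : vsheaf) (Q : pairing F) :=
  forall (x : T) (a : stalk F x), (forall b, stalk_form Q a b = 0) -> a = 0.

End Sheaves.

Section Smoothness.
Variable R : realType.

Definition has_derivative_on (A : set R) (f f' : R -> R) :=
  forall x, A x -> (fun y => (f y - f x) / (y - x)) @ within A x^' --> f' x.

(* C^oo on [A], with derivatives taken within [A]; this is meant for relatively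
   open subsets [A] of an interval, where it gives one-sided derivatives at the
   end points of the interval that belong to [A]. *)
Definition smooth_on (A : set R) (f : R -> R) :=
  exists2 d : nat -> R -> R, d 0%N = f &
    forall n, has_derivative_on A (d n) (d n.+1).

Variable T : topologicalType.

Definition smooth_pairings (F : vsheaf R T) (A : set R) (Q : R -> pairing F) :=
  forall (x : T) (a b : stalk F x), smooth_on A (fun s => stalk_form (Q s) a b).

(* Since stalks are finite dimensional, smoothness of linear maps is tested on
   matrix coefficients. *)
Definition smooth_homs (F : local_system R T) (A : set R)
    (f : R -> vsheaf_hom F F) :=
  forall (x : T) (l : {linear stalk F x -> R^o}) (a : stalk F x),
    smooth_on A (fun s => l (stalk_map (f s) a)).

End Smoothness.

(* Main.v *)
From HB Require Import structures.
Require Import Defs.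
From mathcomp Require Import all_boot all_order all_algebra.
From mathcomp Require Import all_classical all_reals all_analysis.
From mathcomp Require Import ring lra.

Set Implicit Arguments.
Unset Strict Implicit.
Unset Printing Implicit Defensive.

Import Order.TTheory GRing.Theory Num.Theory numFieldNormedType.Exports.
Local Open Scope classical_set_scope.
Local Open Scope ring_scope.

(** Fix [s0].  Since [Q s] is nondegenerate, [Q s0] equals [Q s (A -) -] for a
    unique endomorphism [A] of the sheaf ([representing_hom]), and both forms
    having the same symmetry makes [A] self-adjoint for [Q s].  If [t] is a
    self-adjoint endomorphism with [t \o t = A], then
    [Q s (t -) (t -) = Q s (t (t -)) - = Q s0].  As [A] is the identity for
    [s = s0], near [s0] there is such a square root close to the identity; it
    has to be found among the endomorphisms of the local system, and it has to
    depend smoothly on [s].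

    This is reduced to matrices at one point [x0].  Gram matrices are locally
    constant in a frame, so two pairings that agree at [x0] agree everywhere,
    the base being connected ([stalk_form_eq_connected]); by nondegeneracy the
    same holds for two endomorphisms.  Hence the endomorphisms of the local
    system are determined by their matrices on the stalk at [x0], and these
    matrices form a finite dimensional algebra [S].  Norms, which would depend on
    the frame, have to be estimated at [x0] alone.

    The square root is [1 + Y] with [Y = (Z - Y^2) / 2] and [Z = A - 1].  The
    right-hand side is a contraction of a small ball, and it preserves the
    closed subspace of matrices in [S] that are self-adjoint; the fixed point
    therefore stays in this subspace ([sqrt_exists]).  Differentiating
    [2 Y + Y^2 = Z] gives the linear equation [2 Y' + Y Y' + Y' Y = Z'], which
    is uniformly invertible for small [Y].  So the difference quotients of [Y]
    converge, the derivative is a rational expression in [Y] and [Z'], and by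
    induction all derivatives exist ([smooth_sqrt]).  Writing the resulting
    matrices in terms of finitely many fixed endomorphisms gives a family of
    endomorphisms that is smooth at every point of the base and not only at
    [x0] ([smooth_isometries]).

    For the global statement, being related by an isometry is an equivalence
    relation on the interval whose classes are open by the local statement
    ([connected_relation]). *)

(** * Smooth functions *)

Section Derivatives.
Variable R : realType.
Implicit Types (A : set R) (f g : R -> R).

Lemma has_derivative_subset A A' f f' : A' `<=` A ->
  has_derivative_on A f f' -> has_derivative_on A' f f'.
Proof.
move=> A'A df x A'x; apply: cvg_trans (df x (A'A _ A'x)).
by apply: cvg_app; exact: within_subset.
Qed.

Lemma has_derivative_cst A (c : R) : has_derivative_on A (fun=> c) (fun=> 0).
Proof.
move=> x _; rewrite (_ : (fun _ => _) = fun=> 0); first exact: cvg_cst.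
by apply/funext => y; rewrite subrr mul0r.
Qed.

Lemma has_derivative_add A f g f' g' :
  has_derivative_on A f f' -> has_derivative_on A g g' ->
  has_derivative_on A (fun s => f s + g s) (fun s => f' s + g' s).
Proof.
move=> df dg x Ax; apply: cvg_trans (cvgD (df x Ax) (dg x Ax)).
apply: near_eq_cvg; apply: nearW => y; rewrite !fctE /=; ring.
Qed.

Lemma near_within_dnbhs A (x : R) : \forall y \near within A x^', A y /\ y != x.
Proof. near=> y; split; near: y; first exact: withinT.
by apply: (cvg_within A); exact: withinT.
Unshelve. all: by end_near. Qed.

Lemma has_derivative_cvg A f f' x : has_derivative_on A f f' -> A x ->
  f @ within A x^' --> f x.
Proof.
move=> df Ax.
have yx : (fun y => y - x) @ within A x^' --> (0 : R).
  rewrite -(subrr x); apply: cvgB; last exact: cvg_cst.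
  move=> P xP; suff : nbhs x (fun y => y != x -> A y -> P y) by [].
  by apply: filterS xP => y Py _ _.
have fx0 : f x = f x + f' x * 0 by rewrite mulr0 addr0.
rewrite [X in _ --> X]fx0.
apply: cvg_trans (cvgD (cvg_cst (f x)) (cvgM (df x Ax) yx)).
apply: near_eq_cvg.
near=> y; have [_ yNx] : A y /\ y != x by near: y; exact: near_within_dnbhs.
by rewrite !fctE /= divfK ?subr_eq0 // addrC subrK.
Unshelve. all: by end_near. Qed.

Lemma has_derivative_mul A f g f' g' :
  has_derivative_on A f f' -> has_derivative_on A g g' ->
  has_derivative_on A (fun s => f s * g s) (fun s => f' s * g s + f s * g' s).
Proof.
move=> df dg x Ax.
apply: cvg_trans (cvgD (cvgM (df x Ax) (has_derivative_cvg dg Ax))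
  (cvgM (cvg_cst (f x)) (dg x Ax))).
apply: near_eq_cvg; apply: nearW => y; rewrite !fctE /=; ring.
Qed.

Lemma has_derivative_inv A f f' : (forall s, A s -> f s != 0) ->
  has_derivative_on A f f' ->
  has_derivative_on A (fun s => (f s)^-1)
    (fun s => -1 * (f' s * ((f s)^-1 * (f s)^-1))).
Proof.
move=> f0 df x Ax.
apply: cvg_trans (cvgM (cvg_cst (-1 : R)) (cvgM (df x Ax)
  (cvgM (cvgV (f0 x Ax) (has_derivative_cvg df Ax)) (cvg_cst (f x)^-1)))).
apply: near_eq_cvg; near=> y.
have [Ay yNx] : A y /\ y != x by near: y; exact: near_within_dnbhs.
have fx := f0 x Ax; have fy := f0 y Ay.
have yx0 : y - x != 0 by rewrite subr_eq0.
rewrite /= /unstable.inv_fun; field; by rewrite fx fy yx0.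
Unshelve. all: by end_near. Qed.

(** No derivative has to be identified: iterating the choice of a derivative
    inside a class that differentiation does not leave produces the whole
    sequence of derivatives. *)
Lemma smooth_on_class A (C : (R -> R) -> Prop) :
  (forall f, C f -> exists2 f', C f' & has_derivative_on A f f') ->
  forall f, C f -> smooth_on A f.
Proof.
move=> dC f Cf.
have /choice[D DP] : forall g : {g | C g}, exists g' : {g | C g},
    has_derivative_on A (sval g) (sval g').
  by move=> [g Cg]; have [g' Cg' gg'] := dC g Cg; exists (exist _ g' Cg').
exists (fun n => sval (iter n D (exist _ f Cf))) => // n; exact: DP.
Qed.

Lemma smooth_on_subset A A' f : A' `<=` A -> smooth_on A f -> smooth_on A' f.
Proof.
by move=> A'A [d d0 dP]; exists d => // n; exact: has_derivative_subset (dP n).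
Qed.

Lemma smooth_on_derivative A f : smooth_on A f ->
  exists2 f', smooth_on A f' & has_derivative_on A f f'.
Proof. by case=> d <- dP; exists (d 1%N) => //; exists (fun n => d n.+1). Qed.

Lemma smooth_on_cst A (c : R) : smooth_on A (fun=> c).
Proof.
apply: (@smooth_on_class A (fun f => exists c, f = fun=> c)); last by exists c.
by move=> _ [a ->]; exists (fun=> 0); [exists 0|exact: has_derivative_cst].
Qed.

(** The rational expressions in the functions of [gen] whose denominators do
    not vanish on [A]. *)
Inductive rational_closure A (gen : (R -> R) -> Prop) : (R -> R) -> Prop :=
| rational_gen f : gen f -> rational_closure A gen f
| rational_add f g : rational_closure A gen f -> rational_closure A gen g ->
    rational_closure A gen (fun s => f s + g s)
| rational_mul f g : rational_closure A gen f -> rational_closure A gen g ->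
    rational_closure A gen (fun s => f s * g s)
| rational_inv f : rational_closure A gen f -> (forall s, A s -> f s != 0) ->
    rational_closure A gen (fun s => (f s)^-1).

(** By the rules of calculus it is enough to differentiate the generators; this
    covers solutions of differential equations with rational right-hand
    side. *)
Lemma smooth_on_rational_closure A (gen : (R -> R) -> Prop) :
  (forall c, gen (fun=> c)) ->
  (forall f, gen f ->
    exists2 f', rational_closure A gen f' & has_derivative_on A f f') ->
  forall f, rational_closure A gen f -> smooth_on A f.
Proof.
move=> gen_cst dgen; apply: smooth_on_class => f.
elim=> {f} [f /dgen //|f g Cf [f' Cf' df] Cg [g' Cg' dg]
  |f g Cf [f' Cf' df] Cg [g' Cg' dg]|f Cf [f' Cf' df] f0].
- exists (fun s => f' s + g' s); first exact: rational_add.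
  exact: has_derivative_add.
- exists (fun s => f' s * g s + f s * g' s).
    by apply: rational_add; apply: rational_mul.
  exact: has_derivative_mul.
- exists (fun s => -1 * (f' s * ((f s)^-1 * (f s)^-1))).
    apply: (@rational_mul A gen (fun=> -1)); first exact: rational_gen.
    by do 2![apply: rational_mul => //]; exact: rational_inv.
  exact: has_derivative_inv.
Qed.

Lemma smooth_on_rational A f : rational_closure A (smooth_on A) f -> smooth_on A f.
Proof.
apply: smooth_on_rational_closure; first exact: smooth_on_cst.
move=> g /smooth_on_derivative[g' sg' dg]; exists g' => //; exact: rational_gen.
Qed.

Section RationalClosure.
Variables (A : set R) (gen : (R -> R) -> Prop).
Hypothesis gen_cst : forall c, gen (fun=> c).
Local Notation C := (rational_closure A gen).

Lemma rational_sum (T : Type) (r : seq T) (P : pred T) (F : T -> R -> R) :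
  (forall i, P i -> C (F i)) -> C (fun s => \sum_(i <- r | P i) F i s).
Proof.
move=> CF; elim: r => [|i r IH].
  by under eq_fun do rewrite big_nil; exact: rational_gen.
case Pi: (P i); under eq_fun do rewrite big_cons Pi; last by [].
by apply: rational_add => //; exact: CF.
Qed.

Lemma rational_prod (T : Type) (r : seq T) (P : pred T) (F : T -> R -> R) :
  (forall i, P i -> C (F i)) -> C (fun s => \prod_(i <- r | P i) F i s).
Proof.
move=> CF; elim: r => [|i r IH].
  by under eq_fun do rewrite big_nil; exact: rational_gen.
case Pi: (P i); under eq_fun do rewrite big_cons Pi; last by [].
by apply: rational_mul => //; exact: CF.
Qed.

Definition rational_mx m n (M : R -> 'M[R]_(m, n)) :=
  forall i j, C (fun s => M s i j).

Lemma rational_addmx m n (M N : R -> 'M[R]_(m, n)) :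
  rational_mx M -> rational_mx N -> rational_mx (fun s => M s + N s).
Proof. by move=> CM CN i j; under eq_fun do rewrite mxE; exact: rational_add. Qed.

Lemma rational_mulmx m n p (M : R -> 'M[R]_(m, n)) (N : R -> 'M[R]_(n, p)) :
  rational_mx M -> rational_mx N -> rational_mx (fun s => M s *m N s).
Proof.
move=> CM CN i j; under eq_fun do rewrite mxE.
by apply: rational_sum => k _; exact: rational_mul.
Qed.

Lemma rational_det n (M : R -> 'M[R]_n) :
  rational_mx M -> C (fun s => \det (M s)).
Proof.
move=> CM; apply: rational_sum => p _; apply: (@rational_mul A gen (fun=> _)).
  exact: rational_gen.
exact: rational_prod.
Qed.

Lemma rational_adj n (M : R -> 'M[R]_n) :
  rational_mx M -> rational_mx (fun s => \adj (M s)).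
Proof.
move=> CM i j; under eq_fun do rewrite mxE.
apply: (@rational_mul A gen (fun=> _)); first exact: rational_gen.
by apply: rational_det => k l; under eq_fun do rewrite !mxE.
Qed.

(** The formula of Cramer for the inverse: unlike [invmx] it is a rational
    expression at every point, also where the matrix is singular. *)
Lemma rational_cramer n (M : R -> 'M[R]_n) :
  (forall s, A s -> M s \in unitmx) -> rational_mx M ->
  rational_mx (fun s => (\det (M s))^-1 *: \adj (M s)).
Proof.
move=> uM CM i j; under eq_fun do rewrite mxE.
apply: rational_mul; last exact: rational_adj.
apply: rational_inv; first exact: rational_det.
by move=> s /uM; rewrite unitmxE unitfE.
Qed.

Lemma rational_mxvec m n (M : R -> 'M[R]_(m, n)) :
  rational_mx M -> rational_mx (fun s => mxvec (M s)).
Proof.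
move=> CM i k; rewrite ord1; case/mxvec_indexP: k => a b.
by under eq_fun do rewrite mxvecE.
Qed.

Lemma rational_vec_mx m n (v : R -> 'rV[R]_(m * n)) :
  rational_mx v -> rational_mx (fun s => vec_mx (v s)).
Proof. by move=> Cv i j; under eq_fun do rewrite mxE. Qed.

End RationalClosure.

Definition smooth_mx A m n (M : R -> 'M[R]_(m, n)) :=
  forall i j, smooth_on A (fun s => M s i j).

End Derivatives.

(** * Square roots of matrices near the identity *)

Section MatrixNorm.
Variable R : realType.

Lemma mx_entry_le m n (M : 'M[R]_(m, n)) i j : `|M i j| <= `|M|.
Proof.
have -> : `|M| = mx_norm M by [].
by rewrite mx_normrE; apply/bigmax_geP; right; exists (i, j).
Qed.

Lemma mx_norm_le m n (M : 'M[R]_(m, n)) c : 0 <= c ->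
  (forall i j, `|M i j| <= c) -> `|M| <= c.
Proof.
move=> c0 Mc; have -> : `|M| = mx_norm M by [].
rewrite mx_normrE.
by apply/bigmax_leP; split=> // -[i j] _; exact: Mc.
Qed.

Lemma mx_norm_mul m n p (A : 'M[R]_(m, n)) (B : 'M[R]_(n, p)) :
  `|A *m B| <= n%:R * `|A| * `|B|.
Proof.
apply: mx_norm_le => [|i j]; first by rewrite !mulr_ge0.
rewrite mxE; apply: le_trans (ler_norm_sum _ _ _) _.
rewrite -mulrA mulr_natl -[n in _ *+ n]card_ord -sumr_const.
by apply: ler_sum => k _; rewrite normrM ler_pM // mx_entry_le.
Qed.

Lemma cvg_mx T (F : set_system T) {FF : Filter F} m n (f : T -> 'M[R]_(m, n))
    (l : 'M[R]_(m, n)) :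
  (forall i j, (fun t => f t i j) @ F --> l i j) -> f @ F --> l.
Proof.
move=> fl; apply/cvgrPdist_le => e e0.
have : \forall t \near F, forall ij : 'I_m * 'I_n, `|l ij.1 ij.2 - f t ij.1 ij.2| <= e.
  by apply: filter_forall => -[i j] /=; move/cvgrPdist_le: (fl i j); apply.
apply: filterS => t lf; apply: mx_norm_le => [|i j]; first exact: ltW.
by rewrite !mxE; exact: (lf (i, j)).
Qed.

Lemma cvg_mx_entry T (F : set_system T) m n (f : T -> 'M[R]_(m, n))
    (l : 'M[R]_(m, n)) i j : f @ F --> l -> (fun t => f t i j) @ F --> l i j.
Proof. 
move=> fl; apply: (@cvg_comp _ _ _ f (fun M => M i j) F _ _ fl).
exact: coord_continuous.
 Qed.

End MatrixNorm.

HB.instance Definition _ (R : realType) m n := Complete.on 'M[R]_(m, n).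

Section SquareRoot.
Variables (R : realType) (n : nat) (r : R).
Hypotheses (r_gt0 : 0 < r) (nr : n%:R * r <= 2^-1).
Implicit Types X Y Z P Q : 'M[R]_n.

Lemma mx_norm_mull P X : `|P| <= r -> `|P *m X| <= 2^-1 * `|X|.
Proof.
move=> Pr; apply: le_trans (mx_norm_mul _ _) _.
by apply: ler_wpM2r => //; apply: le_trans nr; exact: ler_wpM2l.
Qed.

Lemma mx_norm_mulr P X : `|P| <= r -> `|X *m P| <= 2^-1 * `|X|.
Proof.
move=> Pr; apply: le_trans (mx_norm_mul _ _) _.
by rewrite mulrAC; apply: ler_wpM2r => //; apply: le_trans nr; exact: ler_wpM2l.
Qed.

Definition sylvester P Q X : 'M[R]_n := X + X + (P *m X + X *m Q).

(** The terms [P *m X] and [X *m Q] together have at most the norm of [X], half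
    that of the leading term [X + X].  Difference quotients and derivatives of
    solutions of [Y + Y + Y *m Y = Z] solve linear equations for this operator,
    and the bound makes it uniformly invertible. *)
Lemma sylvester_bound P Q X : `|P| <= r -> `|Q| <= r -> `|X| <= `|sylvester P Q X|.
Proof.
move=> Pr Qr.
have PX := mx_norm_mull X Pr; have XQ := mx_norm_mulr X Qr.
have : `|X + X| <= `|sylvester P Q X| + `|P *m X + X *m Q|.
  by rewrite -[X in `|X| <= _](addrK (P *m X + X *m Q)); exact: ler_normB.
have PXQ := ler_normD (P *m X) (X *m Q).
rewrite -mulr2n normrMn; lra.
Qed.

Lemma sqrt_divided_difference Y1 Y2 :
  sylvester Y1 Y2 (Y1 - Y2) = (Y1 + Y1 + Y1 *m Y1) - (Y2 + Y2 + Y2 *m Y2).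
Proof.
rewrite /sylvester mulmxBr mulmxBl; move: (Y1 *m Y1) (Y1 *m Y2) (Y2 *m Y2).
by move=> a b c; apply/matrixP => i j; rewrite !mxE; ring.
Qed.

(** The map [Y |-> (Z - Y^2) / 2] contracts the ball of radius [r] by the factor
    1/2.  Working inside [S] keeps the solution in every closed set that the map
    preserves. *)
Lemma sqrt_exists (S : set 'M[R]_n) Z : closed S -> S 0 ->
  (forall Y, S Y -> S (2^-1 *: (Z - Y *m Y))) -> `|Z| <= r ->
  exists Y, [/\ S Y, `|Y| <= r & Y + Y + Y *m Y = Z].
Proof.
move=> clS S0 SZ Zr.
pose U : set 'M[R]_n := S `&` [set Y | `|Y| <= r].
pose f Y : 'M[R]_n := 2^-1 *: (Z - Y *m Y).
have fU : {homo f : Y / U Y >-> U Y}.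
  move=> Y [SY Yr]; split; first exact: SZ.
  have fY : `|f Y| = 2^-1 * `|Z - Y *m Y| by rewrite normrZ ger0_norm.
  have YYr : `|Y *m Y| <= 2^-1 * `|Y| := mx_norm_mull Y Yr.
  have ZY : `|Z - Y *m Y| <= `|Z| + `|Y *m Y| := ler_normB _ _.
  have {}Yr : `|Y| <= r := Yr.
  suff : `|f Y| <= r by [].
  by have r0 := r_gt0; rewrite fY; lra.
have clU : closed U.
  apply: closedI clS _; apply: (@preimage_closed _ _ _ [set x | x <= r]).
    by move=> Y _; exact: norm_continuous.
  exact: closed_le.
have ctrf : is_contraction (mkfun fU : {fun U >-> U}).
  have h0 : 0 <= 2^-1 :> R by [].
  exists (NngNum h0); split=> /=; first by lra.
  move=> -[Y1 Y2] [[_ /= Y1r] [_ /= Y2r]].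
  rewrite /f -scalerBr normrZ ger0_norm // ler_pM2l //.
  have -> : Z - Y1 *m Y1 - (Z - Y2 *m Y2) =
      - (Y1 *m (Y1 - Y2) + (Y1 - Y2) *m Y2) :> 'M[R]_n.
    rewrite mulmxBr mulmxBl; move: (Y1 *m Y1) (Y1 *m Y2) (Y2 *m Y2).
    by move=> a b c; apply/matrixP => i j; rewrite !mxE; ring.
  rewrite normrN; apply: le_trans (ler_normD _ _) _.
  have := mx_norm_mull (Y1 - Y2) Y1r; have := mx_norm_mulr (Y1 - Y2) Y2r; lra.
have U0 : U !=set0 by exists 0; split=> //=; rewrite normr0 ltW.
have [Y [SY Yr] Yf] := banach_fixed_point ctrf clU U0.
exists Y; split=> //; rewrite -mulr2n -scaler_nat {1}Yf /= /f scalerA divff //.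
by rewrite scale1r subrK.
Qed.

Lemma sylvester_linear P Q : linear (sylvester P Q).
Proof.
move=> a X1 X2; rewrite /sylvester mulmxDr mulmxDl -scalemxAr -scalemxAl.
move: (P *m X1) (P *m X2) (X1 *m Q) (X2 *m Q) => b c d e.
by apply/matrixP => i j; rewrite !mxE; ring.
Qed.

HB.instance Definition _ P Q :=
  GRing.isLinear.Build R 'M[R]_n 'M[R]_n *:%R (sylvester P Q)
    (sylvester_linear P Q).

Lemma lin_mx_sylvester_unit P Q : `|P| <= r -> `|Q| <= r ->
  lin_mx (sylvester P Q) \in unitmx.
Proof.
move=> Pr Qr; rewrite unitmxE unitfE; apply/negP => /det0P[v v0].
rewrite mul_rV_lin => /(canRL mxvecK); rewrite linear0 => Sv.
have := sylvester_bound (vec_mx v) Pr Qr; rewrite Sv normr0 normr_le0 => /eqP.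
by move=> /(canRL vec_mxK) v0E; rewrite v0E linear0 eqxx in v0.
Qed.

(** Let [W] be the solution of [sylvester Y Y W = Z'].  The difference quotient
    of [Y] between [x] and [y] solves the same equation with [Y y] for the first
    [Y] and the difference quotient of [Z] for [Z'], so by [sylvester_bound] it
    tends to [W x].  Thus [W] is the derivative of [Y]; since it is rational in
    [Y] and [Z'], the equation can be differentiated again, indefinitely. *)
Lemma smooth_sqrt (A : set R) (Y Z : R -> 'M[R]_n) : smooth_mx A Z ->
  (forall s, A s -> `|Y s| <= r) ->
  (forall s, A s -> Y s + Y s + Y s *m Y s = Z s) -> smooth_mx A Y.
Proof.
move=> sZ Yr YZ.
have /choice[Z'_ Z'P] (ij : 'I_n * 'I_n) : exists g : R -> R,
    smooth_on A g /\ has_derivative_on A (fun s => Z s ij.1 ij.2) g.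
  by have [g] := smooth_on_derivative (sZ ij.1 ij.2); exists g.
pose Z' s := \matrix_(i, j) Z'_ (i, j) s.
pose gen f := smooth_on A f \/ exists i j, f = fun s => Y s i j.
have gen_cst c : gen (fun=> c) by left; exact: smooth_on_cst.
(* [K s] is the matrix of [sylvester (Y s) (Y s)] on vectorized matrices, and
   [W s] the solution that Cramer's rule gives. *)
pose K s := lin_mx (sylvester (Y s) (Y s)).
pose W s := vec_mx (mxvec (Z' s) *m ((\det (K s))^-1 *: \adj (K s))).
have uK s : A s -> K s \in unitmx by move=> As; apply: lin_mx_sylvester_unit; exact: Yr.
have SW s : A s -> sylvester (Y s) (Y s) (W s) = Z' s.
  move=> As; apply: (can_inj mxvecK); rewrite -mul_vec_lin /W vec_mxK -mulmxA.
  rewrite -scalemxAl mul_adj_mx -mul_scalar_mx -scalar_mxM mulVf ?mulmx1 //.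
  by have := uK s As; rewrite unitmxE unitfE.
have rY : rational_mx A gen Y.
  by move=> i j; apply: rational_gen; right; exists i, j.
have rZ' : rational_mx A gen Z'.
  move=> i j; apply: rational_gen; left; under eq_fun do rewrite mxE.
  by case: (Z'P (i, j)).
have rK : rational_mx A gen K.
  move=> i j; under eq_fun do rewrite mxE; move: j; pose X := vec_mx (delta_mx 0 i) : 'M[R]_n.
  have rX : rational_mx A gen (fun=> X) by move=> k l; exact: rational_gen.
  suff : rational_mx A gen (fun s => mxvec (sylvester (Y s) (Y s) X)) by apply.
  apply: rational_mxvec; apply: rational_addmx; first exact: rational_addmx.
  by apply: rational_addmx; exact: rational_mulmx.
have rW : rational_mx A gen W.
  apply: rational_vec_mx; apply: rational_mulmx => //; first exact: rational_mxvec.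
  exact: rational_cramer.
move=> i j; apply: (smooth_on_rational_closure gen_cst); last exact: rY.
move=> f [/smooth_on_derivative[g sg dg]|[k [l ->]]].
  by exists g => //; apply: rational_gen; left.
exists (fun s => W s k l); first exact: rW.
move=> {i j} x Ax.
have Zx : Z @ within A x^' --> Z x.
  apply: cvg_mx => i j; have [_ dZ] := Z'P (i, j); exact: has_derivative_cvg dZ Ax.
have dZx : (fun y => (y - x)^-1 *: (Z y - Z x)) @ within A x^' --> Z' x.
  apply: cvg_mx => i j; have [_ dZ] := Z'P (i, j); rewrite mxE.
  by under eq_fun do rewrite !mxE mulrC; exact: dZ.
suff dYx : (fun y => (y - x)^-1 *: (Y y - Y x)) @ within A x^' --> W x.
  have := @cvg_mx_entry _ _ _ _ _ _ _ k l dYx.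
  by under eq_fun do rewrite !mxE mulrC.
apply/cvgrPdist_le => e e0.
pose c := n%:R * `|W x| + 1.
have c_gt0 : 0 < c by rewrite ltr_wpDl // mulr_ge0.
near=> y.
have Ay : A y by near: y; exact: withinT.
have dZe : `|Z' x - (y - x)^-1 *: (Z y - Z x)| <= e / 2.
  by near: y; move/cvgrPdist_le: dZx; apply; rewrite divr_gt0.
have Ze : `|Z x - Z y| <= e / 2 / c.
  by near: y; move/cvgrPdist_le: Zx; apply; rewrite !divr_gt0.
have Ye : `|Y y - Y x| <= e / 2 / c.
  apply: le_trans Ze; rewrite (distrC (Z x)) -!YZ // -sqrt_divided_difference.
  by apply: sylvester_bound; exact: Yr.
have := sylvester_bound (W x - (y - x)^-1 *: (Y y - Y x)) (Yr y Ay) (Yr x Ax).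
have -> : sylvester (Y y) (Y x) (W x - (y - x)^-1 *: (Y y - Y x)) =
    (Z' x - (y - x)^-1 *: (Z y - Z x)) + (Y y - Y x) *m W x.
  rewrite linearB linearZ /= sqrt_divided_difference !YZ // -SW //.
  rewrite /sylvester mulmxBl; move: (Y y *m W x) (Y x *m W x) (W x *m Y x) => a b d.
  by apply/matrixP => p q; rewrite !mxE; ring.
move=> /le_trans; apply; apply: le_trans (ler_normD _ _) _.
rewrite (splitr e) lerD //; apply: le_trans (mx_norm_mul _ _) _.
have -> : n%:R * `|Y y - Y x| * `|W x| = `|Y y - Y x| * (n%:R * `|W x|) by ring.
apply: (@le_trans _ _ (e / 2 / c * c)); last by rewrite divfK // gt_eqF.
by apply: ler_pM => //; rewrite lerDl.
Unshelve. all: by end_near. Qed.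

End SquareRoot.

(** * Subspaces of matrices *)

Section MatrixSubspace.
Variables (R : realType) (m n : nat) (P : 'M[R]_(m, n) -> Prop).
Hypotheses (P0 : P 0) (P_linear : forall a X Y, P X -> P Y -> P (a *: X + Y)).

Lemma subspace_mulmx k (u : 'rV[R]_k) (D : 'M[R]_(k, m * n)) :
  (forall i, P (vec_mx (row i D))) -> P (vec_mx (u *m D)).
Proof.
move=> PD; rewrite mulmx_sum_row linear_sum /=; elim/big_rec: _ => // i v _ Pv.
by rewrite linearZ /=; exact: P_linear.
Qed.

(** Provides coordinates that inherit smoothness at once: the coefficients of an
    element [X] with respect to the spanning family of the rows of [p] can be
    taken to be the entries of [X].  The projection exists because a family in
    the subspace of maximal rank spans it. *)
Lemma subspace_projection : exists p : 'M[R]_(m * n),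
  (forall i, P (vec_mx (row i p))) /\
  forall X, P X -> mxvec X *m p = mxvec X.
Proof.
pose rk r := `[< exists D : 'M[R]_(m * n),
  (forall i, P (vec_mx (row i D))) /\ \rank D = r >].
have rk0 : exists r, rk r.
  by exists 0%N; apply/asboolP; exists 0; rewrite mxrank0; split=> // i;
    rewrite row0 linear0.
have rk_max r : rk r -> (r <= m * n)%N.
  by move=> /asboolP[D [_ <-]]; exact: rank_leq_row.
case: (ex_maxnP rk0 rk_max) => r /asboolP[D [PD rD]] maxr.
have subD X : P X -> (mxvec X <= D)%MS.
  move=> PX; apply: contraT => XD.
  have DX : (D < D + mxvec X)%MS.
    rewrite ltmxE addsmxSl /=; apply: contra XD; apply: submx_trans.
    exact: addsmxSr.
  have := rank_ltmx DX; rewrite rD ltnNge => /negP[]; apply: maxr; apply/asboolP.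
  exists (D + mxvec X)%MS; split=> // i.
  have /sub_addsmxP[u ->] := row_sub i (D + mxvec X)%MS.
  rewrite linearD /= -[vec_mx (u.1 *m D)]scale1r; apply: P_linear.
    exact: subspace_mulmx.
  by rewrite [u.2]mx11_scalar mul_scalar_mx linearZ /= mxvecK -[_ *: _]addr0;
    exact: P_linear.
exists (pinvmx D *m D); split=> [i|X PX].
  by rewrite row_mul; exact: subspace_mulmx.
by rewrite mulmxA mulmxKpV // subD.
Qed.

(** The subspace is the fixed set of a projection, and the distance of [X] to
    its projection is bounded by a multiple of its distance to any fixed
    point. *)
Lemma subspace_closed : closed (P : set 'M[R]_(m, n)).
Proof.
have [p [Pp pP]] := subspace_projection.
suff clP (X : 'M[R]_(m, n)) : closure P X -> P X by exact: clP.
move=> clX; suff fixX : mxvec X *m p - mxvec X = 0.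
  have {}fixX : mxvec X *m p = mxvec X by apply/eqP; rewrite -subr_eq0 fixX.
  rewrite -[X]mxvecK -fixX.
  exact: subspace_mulmx.
apply/eqP; rewrite -normr_le0; apply/ler_addgt0Pl => e e0; rewrite addr0.
pose c := (m * n)%:R * `|p| + 1.
have c_gt0 : 0 < c by rewrite ltr_wpDl // mulr_ge0.
have {clX} [Y PY XY] : exists2 Y : 'M[R]_(m, n), P Y & `|X - Y| < e / c.
  have [|Y [PY]] := clX (ball X (e / c)); first exact/nbhsx_ballx/divr_gt0.
  by rewrite -ball_normE; exists Y.
have XYn : `|mxvec (X - Y)| <= `|X - Y|.
  apply: mx_norm_le => // i k; rewrite ord1; case/mxvec_indexP: k => a b.
  by rewrite mxvecE mx_entry_le.
have -> : mxvec X *m p - mxvec X = mxvec (X - Y) *m p - mxvec (X - Y).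
  have -> : mxvec (X - Y) = mxvec X - mxvec Y by rewrite linearB.
  by rewrite mulmxBl (pP Y PY) opprB addrA subrK.
apply: le_trans (ler_normB _ _) _.
apply: (@le_trans _ _ (`|X - Y| * c)); last first.
  by rewrite -ler_pdivlMr //; exact: ltW.
rewrite /c mulrDr mulr1 lerD //; apply: le_trans (mx_norm_mul _ _) _.
by rewrite mulrAC mulrC ler_wpM2r // mulr_ge0.
Qed.

End MatrixSubspace.

(** * Families of forms with a prescribed algebra of symmetries *)

Section FormFamily.
Variables (R : realType) (n : nat) (S : 'M[R]_n -> Prop).
Hypotheses (S_linear : forall a X Y, S X -> S Y -> S (a *: X + Y)) (S1 : S 1%:M).
Hypothesis S_sqr : forall X, S X -> S (X *m X).

(** With [C = G s0 *m invmx (G s)] the common symmetry of the forms gives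
    [C *m G s = G s *m C^T].  A square root [B] of [C] with the same property
    satisfies [B *m G s *m B^T = B *m B *m G s = G s0].  The solution [B] stays
    in [S] although [S] is only assumed to be closed under squares, because the
    iteration that defines it involves no other product. *)
Lemma congruent_form_family (A : set R) (G : R -> 'M[R]_n) (s0 eps : R) :
  A s0 -> smooth_mx A G -> (forall s, A s -> G s \in unitmx) ->
  (forall s, A s -> (G s)^T = eps *: G s) ->
  (forall s, A s -> S (G s0 *m invmx (G s))) ->
  exists2 d : R, 0 < d & exists B : R -> 'M[R]_n,
    smooth_mx (A `&` ball s0 d) B /\
    forall s, (A `&` ball s0 d) s -> S (B s) /\ B s *m G s *m (B s)^T = G s0.
Proof.
move=> As0 sG uG tG SG.
have S0 : S 0 by have := S_linear (-1) S1 S1; rewrite scaleN1r addNr.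
(* The product of two matrices may exceed the product of their maximum norms
   by the factor [n], whence the radius. *)
pose r : R := (2 * n.+1%:R)^-1.
have r_gt0 : 0 < r by rewrite invr_gt0 mulr_gt0.
have nr : n%:R * r <= 2^-1.
  by rewrite /r invfM mulrCA ler_piMr // ler_pdivrMr // mul1r ler_nat.
pose C s := G s0 *m ((\det (G s))^-1 *: \adj (G s)).
have CE s : A s -> C s = G s0 *m invmx (G s).
  by move=> As; rewrite /C /invmx uG.
pose Z s := -1%:M + C s.
have sZ : smooth_mx A Z.
  move=> i j; apply: smooth_on_rational.
  have gen_cst c : smooth_on A (fun=> c) by exact: smooth_on_cst.
  have rc (M : 'M[R]_n) : rational_mx A (smooth_on A) (fun=> M).
    by move=> k l; exact: rational_gen.
  move: i j; apply: rational_addmx => //; apply: rational_mulmx => //.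
  by apply: rational_cramer => // k l; apply: rational_gen; exact: sG.
have Z0 : Z s0 = 0 by rewrite /Z CE // mulmxV ?uG // addNr.
have [d d0 Zd] : exists2 d : R, 0 < d & forall s, A s -> ball s0 d s -> `|Z s| <= r.
  have cZ : Z @ within A s0^' --> Z s0.
    by apply: cvg_mx => i j; have [g _ /has_derivative_cvg] := smooth_on_derivative (sZ i j); apply.
  have : \forall s \near within A s0^', `|Z s0 - Z s| <= r.
    by move/cvgrPdist_le: cZ; apply.
  rewrite Z0 => /nbhs_ballP[d d0 dP]; exists d => // s As ds.
  have [->|ss0] := eqVneq s s0; first by rewrite Z0 normr0 ltW.
  by have := dP s ds ss0 As; rewrite sub0r normrN.
have selfadj s : A s -> C s *m G s = G s *m (C s)^T.
  move=> As; rewrite CE // -mulmxA mulVmx ?uG // mulmx1 trmx_mul trmx_inv.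
  by rewrite (tG s0 As0) -!scalemxAr mulmxA scalemxAl scalemxAl -tG // mulmxV
    ?unitmx_tr ?uG // mul1mx.
pose S' s X := S X /\ X *m G s = G s *m X^T.
have S'_linear s a X Y : S' s X -> S' s Y -> S' s (a *: X + Y).
  move=> [SX XG] [SY YG]; split; first exact: S_linear.
  by rewrite mulmxDl -scalemxAl XG YG linearP /= mulmxDr scalemxAr.
have S'0 s : S' s 0 by split; rewrite // mul0mx trmx0 mulmx0.
have S'Z s : A s -> S' s (Z s).
  move=> As; split.
    by rewrite /Z -scaleN1r; apply: S_linear => //; rewrite CE //; exact: SG.
  by rewrite /Z mulmxDl selfadj // linearD linearN /= trmx1 mulmxDr mulNmx
    mulmxN mul1mx mulmx1.
have S'_sqr s X : S' s X -> S' s (X *m X).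
  move=> [SX XG]; split; first exact: S_sqr.
  by rewrite -mulmxA XG mulmxA XG trmx_mul mulmxA.
have /choice[Y YP] s : exists Y : 'M[R]_n, (A `&` ball s0 d) s ->
    [/\ S' s Y, `|Y| <= r & Y + Y + Y *m Y = Z s].
  have [[As ds]|nAs] := pselect ((A `&` ball s0 d) s); last by exists 0 => /nAs.
  have [||||Y YP] := @sqrt_exists R n r r_gt0 nr (S' s) (Z s); last by exists Y.
  - by apply: subspace_closed; [exact: S'0|exact: S'_linear].
  - exact: S'0.
  - move=> X S'X; rewrite addrC -scaleN1r -[_ *: _]addr0; apply: (S'_linear) => //.
    by apply: (S'_linear); [exact: S'_sqr|exact: S'Z].
  - exact: Zd.
exists d => //; exists (fun s => 1%:M + Y s); split.
  have sY : smooth_mx (A `&` ball s0 d) Y.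
    apply: (smooth_sqrt nr (Z := Z)) => [i j|s /YP[]|s /YP[]] //.
    by apply: smooth_on_subset (sZ i j) => s [].
  move=> i j; under eq_fun do rewrite mxE.
  apply: smooth_on_rational; apply: (@rational_add _ _ _ (fun=> _)).
    by apply: rational_gen; exact: smooth_on_cst.
  by apply: rational_gen; exact: sY.
move=> s ABs; have [As _] := ABs; have [[SY YG] _ YZ] := YP s ABs.
split; first by rewrite -[1%:M]scale1r; exact: S_linear.
have GB : G s *m (1%:M + Y s)^T = (1%:M + Y s) *m G s.
  by rewrite linearD /= trmx1 mulmxDr mulmxDl YG mulmx1 mul1mx.
have BB : (1%:M + Y s) *m (1%:M + Y s) = C s.
  rewrite mulmxDl mul1mx mulmxDr mulmx1 [RHS](_ : _ = 1%:M + Z s).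
    by rewrite -YZ !addrA.
  by rewrite /Z addrA subrr add0r.
by rewrite -mulmxA GB mulmxA BB CE // mulmxKV ?uG.
Qed.

End FormFamily.

(** * Stalks and sections *)

Arguments res {R T v V W} WV.

Section Stalks.
Variables (R : realType) (T : topologicalType).
Implicit Types (F G : vsheaf R T) (V W : set T) (x y : T).

Lemma sec_eq_germ F V (oV : open V) (s t : sec F V) :
  (forall x (Vx : V x), germ oV Vx s = germ oV Vx t) -> s = t.
Proof.
move=> st.
pose D W := open W /\ exists WV : W `<=` V, res WV s = res WV t.
apply: (@sheaf_locality _ _ F D V) => [W []//||W WV [oW [WV' stW]]]; last first.
  by rewrite (Prop_irrelevance WV WV').
apply/seteqP; split=> [x Vx|x [W [oW [WV _]] /WV]//].
have /germP[W [WV [WV' [oW Wx stW]]]] := st x Vx.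
exists W => //; split=> //; exists WV; rewrite stW.
by rewrite (Prop_irrelevance WV WV').
Qed.

Section Germ.
Variables (F : vsheaf R T) (x : T) (V : set T) (oV : open V) (Vx : V x).

Lemma germ_linear : linear (germ oV Vx : sec F V -> stalk F x).
Proof. by move=> a s t; rewrite -stalk_addE -stalk_scaleE. Qed.

HB.instance Definition _ :=
  GRing.isLinear.Build R (sec F V) (stalk F x) *:%R (germ oV Vx) germ_linear.

End Germ.

Lemma stalk_map_linear F G (f : vsheaf_hom F G) x : linear (@stalk_map R T F G f x).
Proof.
move=> k a b; have [V [oV [Vx [s [t [-> ->]]]]]] := germ_surj2 a b.
by rewrite -germ_linear !stalk_mapE -germ_linear linearP.
Qed.

HB.instance Definition _ F G (f : vsheaf_hom F G) x :=
  GRing.isLinear.Build R (stalk F x) (stalk G x) *:%R (stalk_map f (x := x))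
    (@stalk_map_linear F G f x).

Lemma stalk_form_linearl F (Q : pairing F) x (b : stalk F x) :
  linear (fun a => stalk_form Q a b : R^o).
Proof.
move=> k a a'; have [V [oV [Vx [s [s' [t [-> -> ->]]]]]]] := germ_surj3 a a' b.
by rewrite -germ_linear !stalk_formE pair_linl.
Qed.

Lemma stalk_form_linearr F (Q : pairing F) x (a : stalk F x) :
  linear (stalk_form Q a : stalk F x -> R^o).
Proof.
move=> k b b'; have [V [oV [Vx [s [t [t' [-> -> ->]]]]]]] := germ_surj3 a b b'.
by rewrite -germ_linear !stalk_formE pair_linr.
Qed.

HB.instance Definition _ F (Q : pairing F) x (a : stalk F x) :=
  GRing.isLinear.Build R (stalk F x) R^o *:%R (stalk_form Q a)
    (stalk_form_linearr Q a).

Definition stalk_forml F (Q : pairing F) x (b a : stalk F x) : R^o := stalk_form Q a b.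

HB.instance Definition _ F (Q : pairing F) x (b : stalk F x) :=
  GRing.isLinear.Build R (stalk F x) R^o *:%R (stalk_forml Q b)
    (stalk_form_linearl Q b).

Lemma stalk_form_eq F (P Q : pairing F) V (u v : sec F V) : open V ->
  (forall x (a b : stalk F x), stalk_form P a b = stalk_form Q a b) ->
  P V u v = Q V u v.
Proof.
move=> oV PQ; apply: cst_sec_eq => x Vx.
by rewrite -!(stalk_formE _ oV Vx) PQ.
Qed.

Lemma stalk_map_eq F G (f g : vsheaf_hom F G) V (u : sec F V) : open V ->
  (forall x (a : stalk F x), stalk_map f a = stalk_map g a) -> f V u = g V u.
Proof.
by move=> oV fg; apply: (@sec_eq_germ _ _ oV) => x Vx; rewrite -!stalk_mapE fg.
Qed.

End Stalks.

(** * Frames of a local system *)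

Section Frames.
Variables (R : realType) (T : topologicalType).
Implicit Types (F : vsheaf R T) (V W : set T) (x y : T).

Definition lincomb n (E : lmodType R) (e : 'I_n -> E) (c : 'rV[R]_n) : E :=
  \sum_i c 0 i *: e i.

Lemma lincomb_linear n (E : lmodType R) (e : 'I_n -> E) : linear (lincomb e).
Proof.
move=> k c d; rewrite /lincomb scaler_sumr -big_split /=.
by apply: eq_bigr => i _; rewrite !mxE scalerDl scalerA.
Qed.

HB.instance Definition _ n (E : lmodType R) (e : 'I_n -> E) :=
  GRing.isLinear.Build R 'rV[R]_n E *:%R (lincomb e) (lincomb_linear e).

Lemma linear_lincomb n (E E' : lmodType R) (f : {linear E -> E'}) (e : 'I_n -> E) c :
  f (lincomb e c) = lincomb (f \o e) c.
Proof. by rewrite linear_sum; apply: eq_bigr => i _; rewrite linearZ. Qed.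

Lemma lincomb_delta n (E : lmodType R) (e : 'I_n -> E) i :
  lincomb e (delta_mx 0 i) = e i.
Proof.
rewrite /lincomb (bigD1 i) //= mxE !eqxx scale1r big1 ?addr0 // => j ji.
by rewrite mxE (negbTE ji) andbF scale0r.
Qed.

Lemma lincomb_rV n (c : 'rV[R]_n) :
  lincomb (fun i => delta_mx 0 i : 'rV[R]_n) c = c.
Proof. by rewrite /lincomb -row_sum_delta. Qed.

Definition is_basis n (E : lmodType R) (e : 'I_n -> E) :=
  (forall a, exists c, a = lincomb e c) /\ forall c, lincomb e c = 0 -> c = 0.

Lemma germ_lincomb F V (oV : open V) x (Vx : V x) n (e : 'I_n -> sec F V) c :
  germ oV Vx (lincomb e c) = lincomb (fun i => germ oV Vx (e i)) c.
Proof. exact: (linear_lincomb (germ oV Vx)). Qed.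

Definition is_frame F V (oV : open V) n (e : 'I_n -> sec F V) :=
  forall x (Vx : V x), is_basis (fun i => germ oV Vx (e i)).

Lemma cst_section_subproof V (E : lmodType R) (v : E) :
  patch (fun=> 0) V (fun=> v) \in lcfun V.
Proof.
apply/lcfunP; split=> x Vx; first by rewrite /patch memNset.
by apply: nearW => y Vy; rewrite /patch !mem_set.
Qed.

Definition cst_section V (E : lmodType R) (v : E) : sec (cst_sheaf T E) V :=
  CstSec (cst_section_subproof V v).

Lemma cst_sectionE V (E : lmodType R) (v : E) x :
  V x -> (cst_section V v : cst_sec E V) x = v.
Proof. by move=> Vx; rewrite /= /patch mem_set. Qed.

Lemma cst_lincombE V (E : lmodType R) n (e : 'I_n -> cst_sec E V) c x :
  (lincomb e c : cst_sec E V) x = lincomb (fun i => e i x) c.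
Proof.
rewrite /lincomb; elim/big_ind2: _ => [|f v g w|i _] //.
by move=> <- <-.
Qed.

Lemma cst_locally_constant V (E : lmodType R) (f : cst_sec E V) x : open V -> V x ->
  exists W, [/\ open W, W x, W `<=` V & forall y, W y -> f y = f x].
Proof.
move=> oV Vx; have /lcfunP[_ /(_ x Vx) fl] := cst_funP f.
have : nbhs x [set y | V y -> f y = f x] by exact: fl.
rewrite nbhsE => -[W [oW Wx] Wf]; exists (V `&` W); split=> //.
- exact: openI.
- by move=> y [Vy Wy]; exact: Wf.
Qed.

(** In a trivialization the constant sections form a frame, because a section of
    the constant sheaf is constant near each point. *)
Lemma exists_frame (L : local_system R T) x :
  exists V (oV : open V) n (e : 'I_n -> sec L V), V x /\ is_frame oV e.
Proof.
have [V [n [phi [oV Vx phi_bij phi_res]]]] := ls_locally_constant L x.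
have [psi phiK psiK] := phi_bij V oV (@subset_refl _ V).
pose e (i : 'I_n) := psi (cst_section V (delta_mx 0 i)).
exists V, oV, n, e; split=> //.
have phi_e W (WV : W `<=` V) c y : open W -> W y ->
    (phi W (res WV (lincomb e c)) : cst_sec _ _) y = c.
  move=> oW Wy; rewrite phi_res // [LHS]cst_resE //.
  rewrite linear_lincomb cst_lincombE -[RHS]lincomb_rV; congr (lincomb _ c).
  by apply/funext => i; rewrite /= /e psiK cst_sectionE //; exact: WV.
move=> y Vy; split=> [a|c].
  have [W [oW [Wy [u ->]]]] := germ_surj a.
  pose VW := V `&` W; have oVW : open VW := openI oV oW.
  pose f : cst_sec 'rV[R]_n VW := phi VW (res (@subIsetr _ V W) u).
  have [W' [oW' W'y W'VW fc]] := cst_locally_constant f oVW (conj Vy Wy).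
  exists (f y); rewrite -germ_lincomb.
  have W'V : W' `<=` V by move=> z /W'VW[].
  have W'W : W' `<=` W by move=> z /W'VW[].
  rewrite -(germ_res W'W oW Wy oW' W'y) -(germ_res W'V oV Vy oW' W'y).
  congr germ; apply: (bij_inj (phi_bij W' oW' W'V)); apply: cst_sec_eq => z W'z.
  rewrite (phi_e W' W'V (f y) z oW' W'z) -(fc z W'z) /f -(cst_resE W'VW) //.
  have -> : res W'W u = res W'VW (res (@subIsetr _ V W) u) by rewrite res_comp.
  by rewrite phi_res //; move=> ? [].
rewrite -germ_lincomb -(linear0 (germ oV Vy)).
move=> /germP[W [WV [WV' [oW Wy]]]]; rewrite linear0 => /(congr1 (phi W)).
by rewrite linear0 => /(congr1 (fun f : cst_sec _ W => f y)); rewrite phi_e.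
Qed.

End Frames.

(** * Pairings of a local system *)

Section Pairings.
Variables (R : realType) (T : topologicalType).
Implicit Types (F : vsheaf R T) (L : local_system R T) (V W : set T) (x y : T).

Definition gram n (E : lmodType R) (q : E -> E -> R) (e : 'I_n -> E) : 'M[R]_n :=
  \matrix_(i, j) q (e i) (e j).

Lemma stalk_form_lincomb F (Q : pairing F) x n (e : 'I_n -> stalk F x) c d :
  stalk_form Q (lincomb e c) (lincomb e d) =
    (c *m gram (stalk_form Q (x := x)) e *m d^T) 0 0.
Proof.
have formr : stalk_form Q (lincomb e c) (lincomb e d) =
    \sum_j d 0 j * stalk_form Q (lincomb e c) (e j).
  exact: (linear_lincomb (stalk_form Q (lincomb e c))).
have forml b : stalk_form Q (lincomb e c) b = \sum_i c 0 i * stalk_form Q (e i) b.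
  exact: (linear_lincomb (stalk_forml Q b)).
rewrite formr mxE; apply: eq_bigr => j _; rewrite forml !mxE mulrC; congr (_ * _).
by apply: eq_bigr => i _; rewrite mxE.
Qed.

Lemma gram_locally_constant F (Q : pairing F) V (oV : open V) n (e : 'I_n -> sec F V)
    x (Vx : V x) :
  \forall y \near x, forall Vy : V y,
    gram (stalk_form Q (x := y)) (fun i => germ oV Vy (e i)) =
    gram (stalk_form Q (x := x)) (fun i => germ oV Vx (e i)).
Proof.
have : \forall y \near x, forall ij : 'I_n * 'I_n, V y ->
    (Q V (e ij.1) (e ij.2) : cst_sec _ V) y =
    (Q V (e ij.1) (e ij.2) : cst_sec _ V) x.
  apply: filter_forall => -[i j] /=.
  by have /lcfunP[_] := cst_funP (Q V (e i) (e j)); apply.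
apply: filterS => y Qy Vy; apply/matrixP => i j.
by rewrite !mxE !stalk_formE; exact: (Qy (i, j)).
Qed.

Lemma locally_invariant_setT (A : T -> Prop) x0 : connected [set: T] ->
  (forall x, \forall y \near x, A y <-> A x) -> A x0 -> forall x, A x.
Proof.
move=> cT Aloc Ax0.
have oA : open (A : set T).
  by rewrite openE => x Ax; move: (Aloc x); apply: filterS => y [_]; apply.
have oAC : open (~` (A : set T)).
  by rewrite openE => x nAx; move: (Aloc x); apply: filterS => y [Ayx _] /Ayx.
have AT : (A : set T) = setT.
  apply: cT; first by exists x0.
    by exists A; rewrite ?setTI.
  by exists A; rewrite ?setTI // -[A]setCK; exact: open_closedC.
by move=> x; have : [set: T] x by []; rewrite -AT.
Qed.

(** Analytic continuation: in a frame both forms have locally constant Gram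
    matrices, so the points where they agree form a closed and open set. *)
Lemma stalk_form_eq_connected L (P Q : pairing L) x0 : connected [set: T] ->
  (forall a b : stalk L x0, stalk_form P a b = stalk_form Q a b) ->
  forall x (a b : stalk L x), stalk_form P a b = stalk_form Q a b.
Proof.
move=> cT; pose A x := forall a b : stalk L x, stalk_form P a b = stalk_form Q a b.
apply: (@locally_invariant_setT A) => // x.
have [V [oV [n [e [Vx frame]]]]] := exists_frame L x.
have Agram y (Vy : V y) : A y <->
    gram (stalk_form P (x := y)) (fun i => germ oV Vy (e i)) =
    gram (stalk_form Q (x := y)) (fun i => germ oV Vy (e i)).
  split=> [Ay|PQ a b]; first by apply/matrixP => i j; rewrite !mxE.
  have [/(_ a)[c ->] _] := frame y Vy; have [/(_ b)[d ->] _] := frame y Vy.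
  by rewrite !stalk_form_lincomb PQ.
have nV : nbhs x V by exact: open_nbhs_nbhs.
near=> y.
have Vy : V y by near: y.
rewrite !(Agram _ Vy) !(Agram _ Vx).
have -> : gram (stalk_form P (x := y)) (fun i => germ oV Vy (e i)) =
    gram (stalk_form P (x := x)) (fun i => germ oV Vx (e i)).
  by move: Vy; near: y; exact: gram_locally_constant.
have -> // : gram (stalk_form Q (x := y)) (fun i => germ oV Vy (e i)) =
    gram (stalk_form Q (x := x)) (fun i => germ oV Vx (e i)).
by move: Vy; near: y; exact: gram_locally_constant.
Unshelve. all: by end_near. Qed.

Lemma gram_unit F (Q : pairing F) x n (e : 'I_n -> stalk F x) :
  nondegenerate_pairing Q -> is_basis e ->
  gram (stalk_form Q (x := x)) e \in unitmx.
Proof.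
move=> ndQ [spane freee]; rewrite unitmxE unitfE; apply/negP => /det0P[c c0 cG].
move/eqP: c0; apply; apply: freee; apply: ndQ => b; have [d ->] := spane b.
by rewrite stalk_form_lincomb cG mul0mx mxE.
Qed.

Lemma nondegenerate_inj F (Q : pairing F) x (a b : stalk F x) :
  nondegenerate_pairing Q ->
  (forall c, stalk_form Q a c = stalk_form Q b c) -> a = b.
Proof.
move=> ndQ ab; apply/eqP; rewrite -subr_eq0; apply/eqP/ndQ => c.
rewrite -[LHS]/(stalk_forml Q c (a - b)) linearB /=.
by rewrite /stalk_forml ab subrr.
Qed.

End Pairings.

Lemma pairing_stalk_sym (R : realType) (T : topologicalType) (F : vsheaf R T)
    (I : set R) (Q : R -> pairing F) :
  (forall s, I s -> symmetric_pairing (Q s)) \/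
    (forall s, I s -> antisymmetric_pairing (Q s)) ->
  exists eps : R, forall s, I s -> forall x (a b : stalk F x),
    stalk_form (Q s) b a = eps * stalk_form (Q s) a b.
Proof.
move=> [symQ|asymQ].
  exists 1 => s Is x a b; have [V [oV [Vx [u [v [-> ->]]]]]] := germ_surj2 a b.
  by rewrite mul1r !stalk_formE (symQ s Is).
exists (-1) => s Is x a b; have [V [oV [Vx [u [v [-> ->]]]]]] := germ_surj2 a b.
by rewrite mulN1r !stalk_formE (asymQ s Is).
Qed.

(** * Endomorphisms of a local system *)

Section Homs.
Variables (R : realType) (T : topologicalType).
Implicit Types (F G H : vsheaf R T) (V W : set T) (x y : T).

Section MkHom.
Variables (F G : vsheaf R T) (f : forall V, sec F V -> sec G V).
Hypothesis f_linear : forall V, linear (@f V).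
Hypothesis f_res : forall V W (WV : W `<=` V) (s : sec F V), open V -> open W ->
  f (res WV s) = res WV (f s).

Definition hom_of_linear V : {linear sec F V -> sec G V} :=
  HB.pack (@f V) (GRing.isLinear.Build R _ _ *:%R (@f V) (@f_linear V)).

Definition mk_hom : vsheaf_hom F G := @VSheafHom _ _ F G hom_of_linear f_res.

End MkHom.

Section Id.
Variable F : vsheaf R T.

Lemma id_hom_linear V : linear (fun s : sec F V => s).
Proof. by []. Qed.

Lemma id_hom_res V W (WV : W `<=` V) (s : sec F V) : open V -> open W ->
  (fun s : sec F W => s) (res WV s) = res WV s.
Proof. by []. Qed.

Definition id_hom : vsheaf_hom F F := mk_hom id_hom_linear id_hom_res.

Lemma stalk_map_id x (a : stalk F x) : stalk_map id_hom a = a.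
Proof. by have [V [oV [Vx [s ->]]]] := germ_surj a; rewrite stalk_mapE. Qed.

End Id.

Section Comp.
Variables (F G H : vsheaf R T) (f : vsheaf_hom G H) (g : vsheaf_hom F G).

Lemma comp_hom_linear V : linear (fun s : sec F V => f V (g V s)).
Proof. by move=> k s t; rewrite !linearP. Qed.

Lemma comp_hom_res V W (WV : W `<=` V) (s : sec F V) : open V -> open W ->
  f W (g W (res WV s)) = res WV (f V (g V s)).
Proof. by move=> oV oW; rewrite !hom_res. Qed.

Definition comp_hom : vsheaf_hom F H := mk_hom comp_hom_linear comp_hom_res.

Lemma stalk_map_comp x (a : stalk F x) :
  stalk_map comp_hom a = stalk_map f (stalk_map g a).
Proof. by have [V [oV [Vx [s ->]]]] := germ_surj a; rewrite !stalk_mapE. Qed.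

End Comp.

Section Lincomb.
Variables (F G : vsheaf R T) (n : nat) (f : 'I_n -> vsheaf_hom F G) (c : 'rV[R]_n).

Lemma lincomb_hom_linear V : linear (fun s : sec F V => lincomb (fun i => f i V s) c).
Proof.
move=> k s t; rewrite /lincomb scaler_sumr -big_split /=; apply: eq_bigr => i _.
by rewrite linearP scalerDr !scalerA mulrC.
Qed.

Lemma lincomb_hom_res V W (WV : W `<=` V) (s : sec F V) : open V -> open W ->
  lincomb (fun i => f i W (res WV s)) c = res WV (lincomb (fun i => f i V s) c).
Proof.
move=> oV oW; rewrite linear_lincomb; congr (lincomb _ c).
by apply/funext => i /=; rewrite hom_res.
Qed.

Definition lincomb_hom : vsheaf_hom F G :=
  mk_hom lincomb_hom_linear lincomb_hom_res.

Lemma stalk_map_lincomb x (a : stalk F x) :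
  stalk_map lincomb_hom a = lincomb (fun i => stalk_map (f i) a) c.
Proof.
have [V [oV [Vx [s ->]]]] := germ_surj a; rewrite stalk_mapE germ_lincomb.
by congr (lincomb _ c); apply/funext => i; rewrite stalk_mapE.
Qed.

End Lincomb.

Section PullbackPairing.
Variables (F : vsheaf R T) (Q : pairing F) (f g : vsheaf_hom F F).

Definition pullback_fun V (s t : sec F V) := Q V (f V s) (g V t).

Lemma pullback_linl V (t : sec F V) : linear (fun s => pullback_fun s t).
Proof. by move=> k s s'; rewrite /pullback_fun linearP pair_linl. Qed.

Lemma pullback_linr V (s : sec F V) : linear (pullback_fun s).
Proof. by move=> k t t'; rewrite /pullback_fun linearP pair_linr. Qed.

Lemma pullback_res V W (WV : W `<=` V) (s t : sec F V) : open V -> open W ->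
  pullback_fun (res WV s) (res WV t) = res WV (pullback_fun s t).
Proof. by move=> oV oW; rewrite /pullback_fun !hom_res // pair_res. Qed.

Definition pullback : pairing F := Pairing pullback_linl pullback_linr pullback_res.

Lemma stalk_form_pullback x (a b : stalk F x) :
  stalk_form pullback a b = stalk_form Q (stalk_map f a) (stalk_map g b).
Proof.
have [V [oV [Vx [s [t [-> ->]]]]]] := germ_surj2 a b.
by rewrite !stalk_mapE !stalk_formE.
Qed.

End PullbackPairing.

(** Tested on germs, so that the relation is local by construction; the proof of
    openness is quantified over because [germ] takes it as an argument. *)
Definition represents F (P Q : pairing F) V (u w : sec F V) :=
  forall (oV : open V) x (Vx : V x) (b : stalk F x),
    stalk_form Q (germ oV Vx u) b = stalk_form P (germ oV Vx w) b.

Section Representation.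
Variables (L : local_system R T) (P Q : pairing L).
Hypothesis ndP : nondegenerate_pairing P.

Lemma represents_linear V k (u u' w w' : sec L V) :
  represents P Q u w -> represents P Q u' w' ->
  represents P Q (k *: u + u') (k *: w + w').
Proof.
move=> uw uw' oV x Vx b; rewrite !germ_linear.
rewrite (stalk_form_linearl Q b) (stalk_form_linearl P b).
by rewrite (uw oV) (uw' oV).
Qed.

Lemma represents_res V W (WV : W `<=` V) (u w : sec L V) : open V -> open W ->
  represents P Q u w -> represents P Q (res WV u) (res WV w).
Proof.
move=> oV oW uw oW' x Wx b.
by rewrite !(germ_res WV oV (WV _ Wx)) (uw oV).
Qed.

Lemma represents_uniq V (u w w' : sec L V) : open V ->
  represents P Q u w -> represents P Q u w' -> w = w'.
Proof.
move=> oV uw uw'; apply: (@sec_eq_germ _ _ _ _ oV) => x Vx.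
by apply: (nondegenerate_inj ndP) => b; rewrite -(uw oV) (uw' oV).
Qed.

(** In a frame where the Gram matrices [GP] and [GQ] are constant, the map with
    constant matrix [GQ *m invmx GP] is a solution. *)
Lemma represents_near V (oV : open V) (u : sec L V) x : V x ->
  exists W (WV : W `<=` V) w, [/\ open W, W x & represents P Q (res WV u) w].
Proof.
move=> Vx; have [V0 [oV0 [n [e [V0x frame]]]]] := exists_frame L x.
have [/(_ (germ oV Vx u))[c uc] _] := frame x V0x.
move: uc; rewrite -germ_lincomb => /germP[W1 [W1V [W1V0 [oW1 W1x uW1]]]].
pose GP := gram (stalk_form P (x := x)) (fun i => germ oV0 V0x (e i)).
pose GQ := gram (stalk_form Q (x := x)) (fun i => germ oV0 V0x (e i)).
have uGP : GP \in unitmx by apply: gram_unit => //; exact: frame.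
have := @filterI _ _ (nbhs_filter x) _ _ (gram_locally_constant P oV0 e V0x)
  (gram_locally_constant Q oV0 e V0x).
rewrite nbhsE => -[W2 [oW2 W2x] W2PQ].
pose W := W1 `&` W2; have WV : W `<=` V by move=> y [/W1V].
have WV0 : W `<=` V0 by move=> y [/W1V0].
have WW1 : W `<=` W1 by move=> y [].
have oW : open W := openI oW1 oW2.
exists W, WV, (res WV0 (lincomb e (c *m GQ *m invmx GP))); split=> //.
have -> : res WV u = res WV0 (lincomb e c).
  by rewrite -(res_comp W1V WW1 WV) // uW1 (res_comp _ _ WV0).
move=> oW' y Wy b; rewrite !(germ_res WV0 oV0 (WV0 _ Wy)) !germ_lincomb.
have [/(_ b)[d ->] _] := frame y (WV0 _ Wy); rewrite !stalk_form_lincomb.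
have [_ W2y] := Wy; have [-> ->] := W2PQ y W2y.
  by rewrite -/GP -/GQ mulmxKV.
Qed.

(** Nondegeneracy makes the local solutions unique, hence they glue. *)
Lemma represents_exists V (u : sec L V) : open V -> exists w, represents P Q u w.
Proof.
move=> oV.
pose D W := open W /\ exists (WV : W `<=` V) w, represents P Q (res WV u) w.
have sW W : {w : sec L W | forall WV : W `<=` V, D W -> represents P Q (res WV u) w}.
  apply: cid; have [[oW [WV [w uw]]]|nD] := pselect (D W); last by exists 0 => WV /nD.
  by exists w => WV' _; rewrite (Prop_irrelevance WV' WV).
pose s W := sval (sW W).
have sP W WV : D W -> represents P Q (res WV u) (s W) by exact: (svalP (sW W)).
have DV W : D W -> W `<=` V by case=> _ [].
have VD : V = \bigcup_(W in D) W.
  apply/seteqP; split=> [x Vx|x [W /DV WV /WV]//].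
  have [W [WV [w [oW Wx uw]]]] := represents_near oV u Vx.
  by exists W => //; split=> //; exists WV, w.
have [||w wP] := @sheaf_gluing _ _ L D V _ VD s.
- by move=> W [].
- move=> W W' DW DW'; have [[oW _] [oW' _]] := (DW, DW').
  have oWW' := openI oW oW'.
  have WW'V : W `&` W' `<=` V by move=> x [/(DV _ DW)].
  apply: (represents_uniq (u := res WW'V u)) => //.
    rewrite -(res_comp (DV _ DW) (@subIsetl _ W W')) //.
    by apply: represents_res => //; exact: sP.
  rewrite -(res_comp (DV _ DW') (@subIsetr _ W W')) //.
  by apply: represents_res => //; exact: sP.
exists w => oV' x Vx b.
have [W DW Wx] : (\bigcup_(W in D) W) x by rewrite -VD.
have [oW _] := DW.
rewrite -!(germ_res (DV _ DW) oV' Vx oW Wx) wP //; exact: sP.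
Qed.

Lemma representing_hom : exists A : vsheaf_hom L L,
  forall x (a b : stalk L x), stalk_form Q a b = stalk_form P (stalk_map A a) b.
Proof.
have A0 V : {f : sec L V -> sec L V | open V -> forall u, represents P Q u (f u)}.
  apply: cid; have [oV|nV] := pselect (open V); last by exists id.
  have /choice[f fP] := fun u => represents_exists u oV.
  by exists f.
(* On a set that is not open the equation says nothing, and any choice that is
   linear will do. *)
pose A V (u : sec L V) := if pselect (open V) is left _ then sval (A0 V) u else 0.
have AP V u : open V -> represents P Q u (A V u).
  by move=> oV; rewrite /A; case: pselect => // _; case: (A0 V) => f /= /(_ oV).
have A_linear V : linear (A V).
  move=> k u v; have [oV|nV] := pselect (open V).
    apply: (represents_uniq oV (AP _ _ oV)).
    by apply: represents_linear; exact: AP.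
  by rewrite /A; case: pselect => // _; rewrite scaler0 addr0.
have A_res V W (WV : W `<=` V) (u : sec L V) : open V -> open W ->
    A W (res WV u) = res WV (A V u).
  move=> oV oW; apply: (represents_uniq oW (AP _ _ oW)).
  by apply: represents_res => //; exact: AP.
exists (mk_hom A_linear A_res) => x a b.
have [V [oV [Vx [u ->]]]] := germ_surj a.
by rewrite stalk_mapE; exact: AP.
Qed.

End Representation.
End Homs.

(** * Isometries *)

Lemma mulmx_delta (R : pzSemiRingType) m n (M : 'M[R]_(m, n)) i j :
  ((delta_mx 0 i : 'rV_m) *m M *m (delta_mx 0 j : 'rV_n)^T) 0 0 = M i j.
Proof. by rewrite trmx_delta -rowE -colE !mxE. Qed.

Section Isometries.
Variables (R : realType) (T : topologicalType) (L : local_system R T) (x0 : T).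
Hypothesis cT : connected [set: T].

Lemma stalk_map_eq_connected (P : pairing L) (f g : vsheaf_hom L L) :
  nondegenerate_pairing P ->
  (forall a : stalk L x0, stalk_map f a = stalk_map g a) ->
  forall x (a : stalk L x), stalk_map f a = stalk_map g a.
Proof.
move=> ndP fg x a; apply: (nondegenerate_inj ndP) => b.
rewrite -[b](stalk_map_id b) -!stalk_form_pullback.
apply: (@stalk_form_eq_connected _ _ _ _ _ x0 cT) => a' b'.
by rewrite !stalk_form_pullback fg.
Qed.

Lemma automorphism_of_inverse (P : pairing L) (f g : vsheaf_hom L L) :
  nondegenerate_pairing P ->
  (forall a : stalk L x0, stalk_map g (stalk_map f a) = a) ->
  (forall a : stalk L x0, stalk_map f (stalk_map g a) = a) ->
  is_automorphism f.
Proof.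
move=> ndP gf fg; exists g => V s oV.
split.
  apply: (@stalk_map_eq _ _ _ _ (comp_hom g f) (id_hom L)) => //.
  apply: (stalk_map_eq_connected ndP) => a.
  by rewrite stalk_map_comp stalk_map_id.
apply: (@stalk_map_eq _ _ _ _ (comp_hom f g) (id_hom L)) => //.
apply: (stalk_map_eq_connected ndP) => a.
by rewrite stalk_map_comp stalk_map_id.
Qed.

Section StalkMatrices.
Variables (n : nat) (e : 'I_n -> stalk L x0).
Hypothesis basis_e : is_basis e.

(** Matrices act on rows of coordinates, so composition of endomorphisms
    reverses the order of the factors. *)
Definition stalk_mx (f : vsheaf_hom L L) (M : 'M[R]_n) :=
  forall c, stalk_map f (lincomb e c) = lincomb e (c *m M).

Lemma exists_stalk_mx f : exists M, stalk_mx f M.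
Proof.
have [span _] := basis_e.
have /choice[r rP] i := span (stalk_map f (e i)).
exists (\matrix_i r i) => c; rewrite linear_lincomb mulmx_sum_row linear_sum /=.
by apply: eq_bigr => i _; rewrite linearZ /= rowK rP.
Qed.

Lemma stalk_mx_inverse f g M N : stalk_mx f M -> stalk_mx g N -> M *m N = 1%:M ->
  forall a : stalk L x0, stalk_map g (stalk_map f a) = a.
Proof.
move=> fM gN MN a; have [span _] := basis_e; have [c ->] := span a.
by rewrite fM gN -mulmxA MN mulmx1.
Qed.

Lemma stalk_mx_id : stalk_mx (id_hom L) 1%:M.
Proof. by move=> c; rewrite stalk_map_id mulmx1. Qed.

Lemma stalk_mx_comp f g M N : stalk_mx f M -> stalk_mx g N ->
  stalk_mx (comp_hom f g) (N *m M).
Proof. by move=> fM gN c; rewrite stalk_map_comp gN fM mulmxA. Qed.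

Lemma stalk_mx_lincomb k (f : 'I_k -> vsheaf_hom L L) (M : 'I_k -> 'M[R]_n) d :
  (forall i, stalk_mx (f i) (M i)) -> stalk_mx (lincomb_hom f d) (lincomb M d).
Proof.
move=> fM c; rewrite stalk_map_lincomb [lincomb M d]/lincomb mulmx_sumr linear_sum /=.
by apply: eq_bigr => i _; rewrite fM -scalemxAr linearZ.
Qed.

Definition stalk_algebra (M : 'M[R]_n) := exists f, stalk_mx f M.

Lemma stalk_algebra_linear a M N : stalk_algebra M -> stalk_algebra N ->
  stalk_algebra (a *: M + N).
Proof.
move=> [f fM] [g gN].
pose fg (i : 'I_2) := if i == 0 then f else g.
pose MN (i : 'I_2) := if i == 0 then M else N.
exists (lincomb_hom fg (\row_i if i == 0 then a else 1)).
have -> : a *: M + N = lincomb MN (\row_i if i == 0 then a else 1).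
  by rewrite /lincomb !big_ord_recl big_ord0 !mxE /= scale1r addr0.
by apply: stalk_mx_lincomb => i; rewrite /fg /MN; case: ifP.
Qed.

Lemma stalk_algebra1 : stalk_algebra 1%:M.
Proof. by exists (id_hom L); exact: stalk_mx_id. Qed.

Lemma stalk_algebra_sqr M : stalk_algebra M -> stalk_algebra (M *m M).
Proof. by move=> [f fM]; exists (comp_hom f f); exact: stalk_mx_comp. Qed.

Local Notation G Q := (gram (stalk_form Q (x := x0)) e).

Lemma gram_pullback (Q P : pairing L) f g M N :
  stalk_mx f M -> stalk_mx g N -> M *m G Q *m N^T = G P ->
  forall a b : stalk L x0,
    stalk_form Q (stalk_map f a) (stalk_map g b) = stalk_form P a b.
Proof.
move=> fM gN MQN a b; have [span _] := basis_e.
have [c ->] := span a; have [d ->] := span b.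
by rewrite fM gN !stalk_form_lincomb -MQN trmx_mul !mulmxA.
Qed.

(** This puts the quotients of the Gram matrices of the family in
    [stalk_algebra], which is what [congruent_form_family] asks of the algebra
    where it looks for square roots. *)
Lemma stalk_mx_representing (P Q : pairing L) (A : vsheaf_hom L L) :
  nondegenerate_pairing P ->
  (forall x (a b : stalk L x), stalk_form Q a b = stalk_form P (stalk_map A a) b) ->
  stalk_mx A (G Q *m invmx (G P)).
Proof.
move=> ndP QA; have [M AM] := exists_stalk_mx A.
suff -> : G Q *m invmx (G P) = M by [].
have -> : G Q = M *m G P; last by rewrite mulmxK // gram_unit.
apply/matrixP => i j; rewrite [LHS]mxE QA -(lincomb_delta e i) AM.
rewrite -(lincomb_delta e j) stalk_form_lincomb.
by rewrite -(mulmxA (delta_mx 0 i)) mulmx_delta.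
Qed.

End StalkMatrices.

(** The matrices [B s] at [x0] extend to endomorphisms [t s] by linear
    combination of the endomorphisms [f k] with coefficients the entries of
    [B s]; smoothness of the coefficients is then smoothness at every point. *)
Lemma smooth_isometries (I : set R) (Q : R -> pairing L) (eps : R) s0 :
  smooth_pairings I Q ->
  (forall s, I s -> nondegenerate_pairing (Q s)) ->
  (forall s, I s -> forall x (a b : stalk L x),
    stalk_form (Q s) b a = eps * stalk_form (Q s) a b) ->
  I s0 ->
  exists2 d : R, 0 < d & exists t : R -> vsheaf_hom L L,
    [/\ forall s, (I `&` ball s0 d) s -> is_automorphism (t s),
        smooth_homs (I `&` ball s0 d) t
      & forall s, (I `&` ball s0 d) s -> forall x (a b : stalk L x),
          stalk_form (Q s) (stalk_map (t s) a) (stalk_map (t s) b) =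
          stalk_form (Q s0) a b].
Proof.
move=> smoothQ ndQ symQ Is0.
have [V [oV [n [e' [Vx0 frame]]]]] := exists_frame L x0.
pose e i := germ oV Vx0 (e' i); have basis_e : is_basis e := frame x0 Vx0.
pose G s := gram (stalk_form (Q s) (x := x0)) e.
have uG s : I s -> G s \in unitmx by move=> /ndQ ndQs; exact: gram_unit.
have smoothG : smooth_mx I G.
  by move=> i j; under eq_fun do rewrite mxE; exact: smoothQ.
have symG s : I s -> (G s)^T = eps *: G s.
  by move=> Is; apply/matrixP => i j; rewrite !mxE symQ.
have GG s : I s -> stalk_algebra e (G s0 *m invmx (G s)).
  move=> Is; have [A AP] := representing_hom (Q s0) (ndQ s Is).
  by exists A; apply: stalk_mx_representing AP => //; exact: ndQ.
have [d d0 [B [smoothB BP]]] := congruent_form_family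
  (@stalk_algebra_linear n e) (stalk_algebra1 e) (@stalk_algebra_sqr n e)
  Is0 smoothG uG symG GG.
have [||p [pS pfix]] := @subspace_projection R n n (stalk_algebra e).
- by have := stalk_algebra_linear (-1) (stalk_algebra1 e) (stalk_algebra1 e);
    rewrite scaleN1r addNr.
- exact: stalk_algebra_linear.
have /choice[f fP] := pS.
pose t s := lincomb_hom f (mxvec (B s)).
have tB s : (I `&` ball s0 d) s -> stalk_mx e (t s) (B s).
  move=> Is; have [SB _] := BP s Is.
  suff -> : B s = lincomb (fun i => vec_mx (row i p)) (mxvec (B s)).
    exact: stalk_mx_lincomb.
  rewrite -[LHS]mxvecK -[in LHS](pfix _ SB) mulmx_sum_row linear_sum.
  by apply: eq_bigr => i _; rewrite linearZ.
have tQ s : (I `&` ball s0 d) s -> forall x (a b : stalk L x),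
    stalk_form (Q s) (stalk_map (t s) a) (stalk_map (t s) b) =
    stalk_form (Q s0) a b.
  move=> Is x a b; rewrite -stalk_form_pullback.
  apply: (@stalk_form_eq_connected _ _ _ _ _ x0 cT) => a' b'.
  rewrite stalk_form_pullback; apply: (gram_pullback basis_e (tB s Is) (tB s Is)).
  by have [_] := BP s Is.
exists d => //; exists t; split=> //.
- move=> s Is; have [_ BGB] := BP s Is; have [Is' _] := Is.
  (* The inverse of [t s] is its adjoint for the pair of forms [Q s], [Q s0]. *)
  have [g gP] := representing_hom (pullback (Q s) (id_hom L) (t s)) (ndQ s0 Is0).
  have gM := stalk_mx_representing basis_e (ndQ s0 Is0) gP.
  have pbG : gram (stalk_form (pullback (Q s) (id_hom L) (t s)) (x := x0)) e =
      G s *m (B s)^T.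
    apply/matrixP => i j; rewrite mxE stalk_form_pullback stalk_map_id.
    rewrite -(lincomb_delta e i) -(lincomb_delta e j) (tB s Is) stalk_form_lincomb.
    by rewrite trmx_mul mulmxA -(mulmxA (delta_mx 0 i)) mulmx_delta.
  have Bg : B s *m (gram (stalk_form (pullback (Q s) (id_hom L) (t s)) (x := x0)) e
      *m invmx (G s0)) = 1%:M.
    by rewrite pbG !mulmxA BGB mulmxV // uG.
  apply: (automorphism_of_inverse (ndQ s0 Is0)).
    exact: (stalk_mx_inverse basis_e (tB s Is) gM).
  by apply: (stalk_mx_inverse basis_e gM (tB s Is)); exact: mulmx1C.
- move=> x l a; under eq_fun do rewrite stalk_map_lincomb linear_lincomb.
  apply: smooth_on_rational; apply: rational_sum => [c|i _].
    exact: smooth_on_cst.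
  apply: (@rational_mul _ _ _ _ (fun=> _)); apply: rational_gen.
    by case/mxvec_indexP: i => i j; under eq_fun do rewrite mxvecE; exact: smoothB.
  exact: smooth_on_cst.
Qed.

End Isometries.

(** * Continuation along connected sets *)

Lemma connected_set_type (X : topologicalType) (U : set X) :
  connected U -> connected [set: set_type U].
Proof.
move=> cU B [u Bu] [C oC BC] [D clD BD]; rewrite setTI in BC; rewrite setTI in BD.
have [C' oC' C'C] := oC.
have [D' oD' D'D] : open (~` D) by exact: closed_openC.
have UB (x : X) (Ux : U x) : B (exist _ x (mem_set Ux)) <-> C' x.
  by rewrite BC -C'C.
have UD (x : X) (Ux : U x) : B (exist _ x (mem_set Ux)) <-> ~ D' x.
  rewrite BD; have : (~` D) (exist _ x (mem_set Ux)) <-> D' x by rewrite -D'D.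
  by move=> [h1 h2]; split=> [Dx /h2|nD'x]; [apply|apply: contrapT => /h1].
have UC' : U `&` C' = U.
  apply: cU.
  - exists (set_val u); split; first exact: set_valP.
    by move: Bu; rewrite BC -C'C.
  - by exists C'.
  - exists (~` D'); first exact: open_closedC.
    apply/seteqP; split=> x [Ux h]; split=> //.
      by apply/(UD x Ux)/(UB x Ux).
    by apply/(UB x Ux)/(UD x Ux).
apply/seteqP; split=> // -[x Ux] _.
have Ux' : U x by exact: set_mem.
have : (U `&` C') x by rewrite UC'.
by move=> [_ /(UB x Ux')]; rewrite (bool_irrelevance (mem_set Ux') Ux).
Qed.

(** The class of [s] and its complement in [I] are both saturated, hence both
    relatively open. *)
Lemma connected_relation (X : topologicalType) (I : set X) (r : X -> X -> Prop) :
  connected I ->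
  (forall s, I s -> \forall s' \near s, I s' -> r s s') ->
  (forall s s', I s -> I s' -> r s s' -> r s' s) ->
  (forall s s' s'', I s -> I s' -> I s'' -> r s s' -> r s' s'' -> r s s'') ->
  forall s s', I s -> I s' -> r s s'.
Proof.
move=> cI r_near r_sym r_trans s s' Is Is'.
have open_sat (A : set X) : (forall a b, I a -> I b -> r a b -> A a -> A b) ->
    exists2 O, open O & I `&` A = I `&` O.
  move=> Asat; exists (I `&` A `|` ~` I)°; first exact: open_interior.
  apply/seteqP; split=> x [Ix h]; split=> //; last first.
    by have [[]|] := interior_subset h.
  rewrite /interior; move: (r_near x Ix); apply: filterS => y rxy.
  have [Iy|nIy] := pselect (I y); [left|by right].
  by split=> //; apply: (Asat x) => //; exact: rxy.
pose A : set X := r s.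
have Asat a b : I a -> I b -> r a b -> A a -> A b.
  by move=> Ia Ib rab sa; apply: (r_trans s a).
have [C oC AC] := open_sat A Asat.
have [C' oC' AC'] : exists2 C, open C & I `&` ~` A = I `&` C.
  by apply: open_sat => a b Ia Ib rab na /(Asat b a Ib Ia (r_sym _ _ Ia Ib rab)).
have IA : I `&` A = I.
  apply: cI.
  - by exists s; split=> //; have /nbhs_singleton := r_near s Is; apply.
  - by exists C.
  - exists (~` C'); first exact: open_closedC.
    have key x : I x -> (A x <-> ~ C' x).
      move=> Ix; have : (I `&` ~` A) x <-> (I `&` C') x by rewrite AC'.
      move=> [h1 h2]; split=> [Ax Ox|nOx].
        by have [] := h2 (conj Ix Ox).
      by apply: contrapT => nAx; have [] := h1 (conj Ix nAx).
    by apply/seteqP; split=> x [Ix h]; split=> //; apply/key.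
by have [] : (I `&` A) s' by rewrite IA.
Qed.

Theorem proposition4p8 (R : realType) (X : variety R)
  (irrX : irreducible_variety X)
  (U : set (analytic X)) (zopU : zariski_open (U : set X)) (U0 : U !=set0)
  (connU : connected U)
  (L : local_system R (set_type U))
  (I : set R) (itvI : is_interval I)
  (Q : R -> pairing L)
  (smoothQ : smooth_pairings I Q)
  (nondegQ : forall s, I s -> nondegenerate_pairing (Q s))
  (symQ : (forall s, I s -> symmetric_pairing (Q s)) \/
          (forall s, I s -> antisymmetric_pairing (Q s))) :
  (exists (J : Type) (I_ : J -> set R),
    [/\ I = \bigcup_j I_ j,
        forall j, exists2 O : set R, open O & I_ j = I `&` O
      & forall j, exists T : R -> vsheaf_hom L L,
        [/\ forall s, I_ j s -> is_automorphism (T s),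
            smooth_homs (I_ j) T
          & forall s s', I_ j s -> I_ j s' ->
              forall V (u v : sec L V), open V ->
                Q s V (T s V u) (T s V v) = Q s' V (T s' V u) (T s' V v)]])
  /\
  (forall s s', I s -> I s' -> exists T : vsheaf_hom L L,
    is_automorphism T /\
    forall V (u v : sec L V), open V -> Q s' V (T V u) (T V v) = Q s V u v).
Proof.
have [x0 Ux0] := U0; pose p0 : set_type U := exist _ x0 (mem_set Ux0).
have cU := connected_set_type connU.
have [eps epsQ] := pairing_stalk_sym symQ.
have loc s0 : I s0 -> exists2 d : R, 0 < d & exists t : R -> vsheaf_hom L L,
    [/\ forall s, (I `&` ball s0 d) s -> is_automorphism (t s),
        smooth_homs (I `&` ball s0 d) t
      & forall s, (I `&` ball s0 d) s -> forall V (u v : sec L V), open V ->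
          Q s V (t s V u) (t s V v) = Q s0 V u v].
  move=> Is0.
  have [d d0 [t [aut smt tQ]]] := smooth_isometries p0 cU smoothQ nondegQ epsQ Is0.
  exists d => //; exists t; split=> // s Is V u v oV.
  apply: (@stalk_form_eq _ _ _ (pullback (Q s) (t s) (t s))) => // x a b.
  by rewrite stalk_form_pullback tQ.
split.
  have /choice[d dP] (j : {s | I s}) : exists d : R, 0 < d /\
      exists t : R -> vsheaf_hom L L,
    [/\ forall s, (I `&` ball (sval j) d) s -> is_automorphism (t s),
        smooth_homs (I `&` ball (sval j) d) t
      & forall s, (I `&` ball (sval j) d) s -> forall V (u v : sec L V), open V ->
          Q s V (t s V u) (t s V v) = Q (sval j) V u v].
    by have [d d0 dP] := loc _ (svalP j); exists d.
  exists {s | I s}, (fun j => I `&` ball (sval j) (d j)); split.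
  - apply/seteqP; split=> [s Is|s [j _ []]//].
    by exists (exist _ s Is) => //; split=> //; apply: ballxx; case: (dP (exist _ s Is)).
  - by move=> j; exists (ball (sval j) (d j)) => //; exact: ball_open.
  - move=> j; have [_ [t [aut smt tQ]]] := dP j; exists t; split=> //.
    by move=> s s' Is Is' V u v oV; rewrite !tQ.
pose r s s' := exists T : vsheaf_hom L L, is_automorphism T /\
  forall V (u v : sec L V), open V -> Q s' V (T V u) (T V v) = Q s V u v.
apply: (@connected_relation _ I r); first exact/connected_intervalP.
- move=> s0 Is0; have [d d0 [t [aut _ tQ]]] := loc s0 Is0.
  apply/nbhs_ballP; exists d => // s ds Is; exists (t s); split; first exact: aut.
  exact: tQ.
- move=> s s' _ _ [f [[g gf] fQ]]; exists g; split.
    by exists f => V u oV; have [] := gf V u oV.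
  move=> V u v oV; rewrite -fQ //.
  by have [_ ->] := gf V u oV; have [_ ->] := gf V v oV.
- move=> s s' s'' _ _ _ [f [[f' f'f] fQ]] [g [[g' g'g] gQ]].
  exists (comp_hom g f); split; last by move=> V u v oV /=; rewrite gQ ?fQ.
  exists (comp_hom f' g') => V u oV /=; split.
    by have [-> _] := g'g V (f V u) oV; have [] := f'f V u oV.
  by have [_ ->] := f'f V (g' V u) oV; have [] := g'g V u oV.
Qed.
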